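(* Let $\rho,\lambda\in[0,1]$. Let $(X_t,\eta(t))_{t\ge 0}$ be the Markov process generated by $L^{\mathrm{joint}}$, started from $X_0=0$ and $\eta(0)\sim\mu$, let $\xi(t)=\theta_{X_t}\eta(t)$, and let $\mathbb P$ be the annealed measure. For any $\epsilon>0$ there exist $T=T(\epsilon)>0$ and $C=C(\epsilon)>0$ such that for any $t>T$, $$\mathbb P\left[\frac1t\left|\int_0^t(2-\lambda\xi_0(s))(\xi_0(s)-\rho)\,\mathrm ds\right|\ge\epsilon\right]\le C\,t^{-\frac1{15}}.$$
   Context: $\mu=\bigotimes_{x\in\mathbb Z}\mathrm{Ber}(\rho)$ is the product measure on $\{0,1\}^{\mathbb Z}$ under which the coordinates are i.i.d. Bernoulli with mean $\rho$. For $\eta\in\{0,1\}^{\mathbb Z}$, $\eta^{y,y+1}$ denotes the configuration obtained from $\eta$ by exchanging the values at $y$ and $y+1$, and for $k\in\mathbb Z$, $(\theta_k\eta)_x=\eta_{x+k}$; thus $\xi_x(t)=\eta_{x+X_t}(t)$. The joint process $(X_t,\eta(t))_{t\ge0}$ of a nearest-neighbour random walk on $\mathbb Z$ and a simple symmetric exclusion process (SSEP) is the Markov process with generator, acting on functions $f(\eta,x)$, $x\in\mathbb Z$, that are local in $\eta\in\{0,1\}^{\mathbb Z}$ (i.e. depend on finitely many coordinates of $\eta$), $$L^{\mathrm{joint}}f(\eta,x)=\sum_{y\in\mathbb Z}\left[f(\eta^{y,y+1},x)-f(\eta,x)\right]+\left[(1-\lambda)\eta_x+(1-\eta_x)\right]\left[f(\eta,x+1)+f(\eta,x-1)-2f(\eta,x)\right].$$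 The annealed measure $\mathbb P$ is the law of the process with both sources of randomness, i.e. $\mathbb P(\cdot)=\int P^\eta(\cdot)\,\mathrm dQ_\mu(\eta)$, where $Q_\mu$ is the law of the SSEP trajectory $\eta=\{\eta(t)\}_{t\ge0}$ with $\eta(0)\sim\mu$ and $P^\eta$ is the law of the walk started at $0$ in the fixed trajectory $\eta$ (jumping at time $t$ to each of its two neighbours at rate $(1-\lambda)\eta_{X_t}(t)+(1-\eta_{X_t}(t))$). *)

(* Defs.v *)
From HB Require Import structures.
From mathcomp Require Import all_boot all_order all_algebra.
From mathcomp Require Import all_classical all_reals all_analysis.
Set Implicit Arguments.
Unset Strict Implicit.
Unset Printing Implicit Defensive.
Import Order.TTheory GRing.Theory Num.Theory.
Import numFieldNormedType.Exports.
Local Open Scope classical_set_scope.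
Local Open Scope ring_scope.

HB.instance Definition _ := isPointed.Build int 0.

HB.instance Definition _ := @isMeasurable.Build default_measure_display
  int discrete_measurable (@discrete_measurable0 int)
  (@discrete_measurableC int) (@discrete_measurableU int).

Definition coordinate_sets : set (set (int -> bool)) :=
  [set A | exists (x : int) (b : bool), A = [set eta | eta x = b]].

(* {0,1}^Z with its product sigma-algebra *)
Definition conf := g_sigma_algebraType coordinate_sets.

Definition state : Type := (conf * int)%type.

Definition exchange (y : int) (eta : conf) : conf := fun x =>
  if x == y then eta (y + 1) else if x == y + 1 then eta y else eta x.

Definition shift_conf (k : int) (eta : conf) : conf := fun x => eta (x + k).

(* [mu] is the product measure: it is determined by its values on boxes with
   finitely many constrained coordinates *)
Definition is_bernoulli_product (R : realType) (rho : R)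
    (mu : set conf -> \bar R) : Prop :=
  forall (s : seq int) (A : int -> set bool), uniq s ->
    mu [set eta | forall x : int, x \in s -> A x (eta x)] =
    (\prod_(x <- s) bernoulli_prob rho (A x))%E.

(* The set of coordinates is uniform in the position of the walk. *)
Definition local (R : realType) (f : state -> R) : Prop :=
  exists s : seq int, forall (eta eta' : conf) (x : int),
    (forall y : int, y \in s -> eta y = eta' y) -> f (eta, x) = f (eta', x).

(* For local [f] only finitely many terms of the sum over [y] are nonzero, so
   that the finitely supported sum is the sum over all of Z. *)
Definition Ljoint (R : realType) (lambda : R) (f : state -> R) (z : state)
    : R :=
  let: (eta, x) := z in
  \sum_(y \in [set: int]) (f (exchange y eta, x) - f (eta, x)) +
  ((1 - lambda) * (eta x)%:R + (1 - (eta x)%:R)) *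
  (f (eta, x + 1) + f (eta, x - 1) - 2 * f (eta, x)).

Section markov.
Context (R : realType) (d : measure_display) (S : measurableType d).
Implicit Types K : R -> R.-pker S ~> S.

Definition transition_semigroup K : Prop :=
  (forall z B, measurable B -> K 0 z B = \d_z B) /\
  (forall (s t : R) (z : S) (B : set S), 0 <= s -> 0 <= t -> measurable B ->
     K (s + t) z B = (\int[K s z]_w K t w B)%E).

(* [L] acts on [f] as the infinitesimal generator of [K], in sup norm *)
Definition generates_on K (L : (S -> R) -> S -> R) (f : S -> R) : Prop :=
  forall e : R, 0 < e -> \forall t \near (0 : R)^'+, forall z,
    `|t^-1 * (\int[K t z]_w f w - f z) - L f z| < e.

Definition natural_filtration (T : Type) (Z : R -> T -> S) (s : R) :
    set (set T) :=
  <<s [set A | exists (u : R) (B : set S),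
         [/\ 0 <= u <= s, measurable B & A = Z u @^-1` B]] >>.

Definition markov_property (d' : measure_display) (T : measurableType d')
    (P : probability T R) (Z : R -> T -> S) K : Prop :=
  forall (s t : R) (A : set T) (B : set S), 0 <= s -> 0 <= t ->
    natural_filtration Z s A -> measurable B ->
    P (A `&` Z (s + t) @^-1` B) = (\int[P]_(w in A) K t (Z s w) B)%E.

(* right-continuous with left limits, for the discrete topology on [U] *)
Definition cadlag (U : Type) (u : R -> U) : Prop :=
  forall t : R, 0 <= t ->
    (\forall s \near t^'+, u s = u t) /\
    (0 < t -> exists a, \forall s \near t^'-, u s = a).

End markov.

(* [(X, eta)] is a version, with cadlag paths, of the Markov process with
   generator [Ljoint lambda] on bounded local functions, started from
   [X_0 = 0] and [eta(0)] of law the product measure of density [rho].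
   Paths in {0,1}^Z are cadlag for the product topology, that is,
   coordinatewise; only times [t >= 0] matter. *)
Record is_joint_process (R : realType) (rho lambda : R) (d : measure_display)
    (T : measurableType d) (P : probability T R)
    (X : R -> T -> int) (eta : R -> T -> conf) : Prop := IsJointProcess {
  joint_measurable : forall t : R, 0 <= t ->
    measurable_fun [set: T] (fun w => (eta t w, X t w) : state) ;
  joint_cadlag_walk : forall w, cadlag (fun t => X t w) ;
  joint_cadlag_conf : forall w y, cadlag (fun t => eta t w y) ;
  joint_walk0 : {ae P, forall w, X 0 w = 0} ;
  joint_conf0 : is_bernoulli_product rho (pushforward P (eta 0)) ;
  joint_markov : exists K : R -> R.-pker state ~> state,
    [/\ transition_semigroup K,
        forall f : state -> R, local f ->
          (exists M : R, forall z, `|f z| <= M) ->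
          generates_on K (Ljoint lambda) f &
        markov_property P (fun t w => (eta t w, X t w) : state) K]
}.

Definition environment (R : realType) (T : Type) (X : R -> T -> int)
    (eta : R -> T -> conf) (t : R) (w : T) : conf :=
  shift_conf (X t w) (eta t w).

(* Main.v *)
Require Import Defs.
From HB Require Import structures.
From mathcomp Require Import all_boot all_order all_algebra.
From mathcomp Require Import all_classical all_reals all_analysis.
From mathcomp Require Import measurable_realfun.
From mathcomp Require Import ring lra zify.
Set Implicit Arguments.
Unset Strict Implicit.
Unset Printing Implicit Defensive.
Import Order.TTheory GRing.Theory Num.Theory.
Import numFieldNormedType.Exports.
Local Open Scope classical_set_scope.
Local Open Scope ring_scope.

(** The argument rests on one algebraic identity. If a function of the
    environment seen from the walk is linear, [f (eta, x) = sum_y a_y eta_(x + y)],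
    then the exchanges turn it into [sum_y a_y (Lap eta)_(x + y)], [Lap] being the
    discrete Laplacian, and a pair of opposite jumps of the walk turns it into the
    same expression times the jump rate [1 - lambda eta_x]. Hence
    [L f = (2 - lambda eta_x) * sum_y (Lap a)_y eta_(x + y)], and the weight
    [2 - lambda eta_x] is that of the observable. Choosing [a] with
    [Lap a = delta_0 - (uniform weight on 0 < |y| <= n)] writes the observable as
    [L f] plus [(2 - lambda eta_x) * (density of eta around x - rho)]
    ([corrector], [Ljoint_corrector], [observable_corrector]).

    The time integral of [L f] is controlled in mean square by the Markov
    property alone: the correlations of [L f] at one time with its later values
    telescope, so that the second moment grows linearly in time
    ([additive_functional_moment]).

    The density term is small because the exclusion process, which evolves
    autonomously, keeps its Bernoulli product law: expectations of products over
    distinct sites solve a closed linear system, whose solution is unique since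
    the system has bounded norm on products of a fixed number of sites
    ([mean_product_obs]). An exponential Chebyshev bound at each position
    ([mean_tilt], [density_tailP]) and a union bound over the positions
    [|x| <= M] follow. The walk is beyond [M ~ t] with small probability, because
    its second moment grows linearly ([mean_walk_spread]); this also pays for the
    cutoff that makes the corrector a local function.

    The semigroup is used only through its behaviour over one small time step
    ([forward_step]): the time integral is a limit of Riemann sums along the grid
    of mesh [t / k] ([riemann_sum_cvg]), all estimates are proved on the grid up
    to errors that vanish with the mesh, and [k] tends to infinity before [t].
    With [n ~ t ^ (1/15)] and [M ~ t] every contribution is
    [O (t ^ (- 1/15))] ([deviation_rate]). *)

(** * Means of bounded measurable functions *)

Section bounded_measurable.
Context {d : measure_display} {T : measurableType d} {R : realType}.
Implicit Types f g : T -> R.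

Definition bounded_measurable f : Prop :=
  measurable_fun [set: T] f /\ exists M : R, forall x, `|f x| <= M.

Lemma bm_cst (r : R) : bounded_measurable (fun=> r).
Proof. by split; [exact: measurable_cst | exists `|r|]. Qed.

Lemma bmD f g : bounded_measurable f -> bounded_measurable g ->
  bounded_measurable (fun x => f x + g x).
Proof.
move=> [mf [M fM]] [mg [N gN]]; split; first exact: measurable_funD.
by exists (M + N) => x; rewrite (le_trans (ler_normD _ _))// lerD.
Qed.

Lemma bmM f g : bounded_measurable f -> bounded_measurable g ->
  bounded_measurable (fun x => f x * g x).
Proof.
move=> [mf [M fM]] [mg [N gN]]; split; first exact: measurable_funM.
by exists (M * N) => x; rewrite normrM ler_pM.
Qed.

Lemma bmZ (r : R) f : bounded_measurable f ->
  bounded_measurable (fun x => r * f x).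
Proof. by move=> bf; apply: bmM => //; exact: bm_cst. Qed.

Lemma bmB f g : bounded_measurable f -> bounded_measurable g ->
  bounded_measurable (fun x => f x - g x).
Proof.
move=> bf /(bmZ (-1)) bg; under eq_fun do rewrite -mulN1r.
exact: bmD.
Qed.

Lemma bm_sum (I : Type) (s : seq I) (h : I -> T -> R) :
  (forall i, bounded_measurable (h i)) ->
  bounded_measurable (fun x => \sum_(i <- s) h i x).
Proof.
move=> bh; elim: s => [|i s IHs].
  by under eq_fun do rewrite big_nil; exact: bm_cst.
by under eq_fun do rewrite big_cons; exact: bmD.
Qed.

Lemma bm_norm f : bounded_measurable f -> bounded_measurable (fun x => `|f x|).
Proof.
move=> [mf [M fM]]; split; first exact: measurableT_comp.
by exists M => x; rewrite normr_id.
Qed.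

Lemma bm_max f g : bounded_measurable f -> bounded_measurable g ->
  bounded_measurable (fun x => Num.max (f x) (g x)).
Proof.
move=> [mf [M fM]] [mg [N gN]]; split; first exact: measurable_maxr.
exists (Num.max M N) => x; rewrite le_max; case: (leP (f x) (g x)) => _.
  by rewrite gN orbT.
by rewrite fM.
Qed.

Lemma bm_indic (A : set T) : measurable A -> bounded_measurable (\1_A : T -> R).
Proof.
move=> mA; split; first exact: measurable_indic.
by exists 1 => x; rewrite indicE; case: (_ \in _); rewrite ?normr1 ?normr0.
Qed.

End bounded_measurable.

Lemma bm_comp (d d' : measure_display) (T : measurableType d) (U : measurableType d')
    (R : realType) (phi : U -> T) (f : T -> R) :
  measurable_fun [set: U] phi -> bounded_measurable f -> bounded_measurable (f \o phi).
Proof.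
by move=> mphi [mf [M fM]]; split; [exact: measurableT_comp | exists M => x; exact: fM].
Qed.

Section mean.
Context {d : measure_display} {T : measurableType d} {R : realType}.
Variable mu : {measure set T -> \bar R}.
Hypothesis mu1 : mu [set: T] = 1%E.
Implicit Types f g : T -> R.

Definition mean f : R := \int[mu]_x f x.

Lemma bm_integrable f : bounded_measurable f ->
  mu.-integrable [set: T] (EFin \o f).
Proof.
move=> [mf [M fM]]; apply: measurable_bounded_integrable => //.
  by rewrite mu1 ltry.
exists M; split; first exact: num_real.
by move=> y My x _; exact: le_trans (fM x) (ltW My).
Qed.

Lemma mean_cst (r : R) : mean (fun=> r) = r.
Proof. by rewrite /mean Rintegral_cst// mu1 mulr1. Qed.

Lemma meanD f g : bounded_measurable f -> bounded_measurable g ->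
  mean (fun x => f x + g x) = mean f + mean g.
Proof. by move=> bf bg; rewrite /mean RintegralD//; exact: bm_integrable. Qed.

Lemma meanB f g : bounded_measurable f -> bounded_measurable g ->
  mean (fun x => f x - g x) = mean f - mean g.
Proof. by move=> bf bg; rewrite /mean RintegralB//; exact: bm_integrable. Qed.

Lemma meanZ (r : R) f : bounded_measurable f ->
  mean (fun x => r * f x) = r * mean f.
Proof. by move=> bf; rewrite /mean RintegralZl//; exact: bm_integrable. Qed.

Lemma mean_sum (I : Type) (s : seq I) (h : I -> T -> R) :
  (forall i, bounded_measurable (h i)) ->
  mean (fun x => \sum_(i <- s) h i x) = \sum_(i <- s) mean (h i).
Proof.
move=> bh; elim: s => [|i s IHs].
  by under eq_fun do rewrite big_nil; rewrite mean_cst big_nil.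
under eq_fun do rewrite big_cons.
by rewrite meanD ?IHs ?big_cons//; exact: bm_sum.
Qed.

Lemma ler_mean f g : bounded_measurable f -> bounded_measurable g ->
  (forall x, f x <= g x) -> mean f <= mean g.
Proof. by move=> bf bg fg; apply: le_Rintegral => //; exact: bm_integrable. Qed.

Lemma eq_mean f g : f =1 g -> mean f = mean g.
Proof. by move=> /funext ->. Qed.

Lemma ler_norm_mean f (M : R) : bounded_measurable f ->
  (forall x, `|f x| <= M) -> `|mean f| <= M.
Proof.
move=> bf fM; rewrite ler_norml -[X in _ <= X <= _]/(mean f).
apply/andP; split; [rewrite -(mean_cst (- M))|rewrite -(mean_cst M)];
  apply: ler_mean => //; try exact: bm_cst.
  by move=> x; have := fM x; rewrite ler_norml => /andP[].
by move=> x; have := fM x; rewrite ler_norml => /andP[].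
Qed.

Lemma mean_indic (A : set T) : measurable A -> (mean \1_A)%:E = mu A.
Proof.
move=> mA; rewrite /mean /Rintegral integral_indic// setIT fineK//.
by rewrite ge0_fin_numE// (le_lt_trans (le_measure mu _ _ (@subsetT _ A)))
  ?inE// [X in (X < _)%E]mu1 ltry.
Qed.

Lemma mean_EFin f : bounded_measurable f ->
  ((mean f)%:E = \int[mu]_x (f x)%:E)%E.
Proof.
move=> bf; rewrite /mean /Rintegral fineK//.
exact: (integrable_fin_num measurableT (bm_integrable bf)).
Qed.

Lemma mean_cvg (h : (T -> R)^nat) f (M : R) :
  (forall k, measurable_fun [set: T] (h k)) ->
  (forall k x, `|h k x| <= M) ->
  (forall x, h ^~ x @ \oo --> f x) ->
  mean (h k) @[k --> \oo] --> mean f.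
Proof.
move=> mh hM hf.
have mf : measurable_fun [set: T] f by exact: (measurable_fun_cvg mh).
have [] := @dominated_convergence _ T R mu setT measurableT
  (fun k x => (h k x)%:E) (EFin \o f) (cst M%:E).
- by move=> k; apply/measurable_EFinP.
- exact/measurable_EFinP.
- apply: aeW => x _ /=; apply: cvg_EFin; last exact: hf.
  by apply: nearW.
- have := @bm_integrable (cst M); apply; exact: bm_cst.
- by apply: aeW => x k _ /=; rewrite lee_fin.
move=> /(integrable_fin_num measurableT) finf _ cvi.
apply: (@fine_cvg _ _ _ _ (fun k => \int[mu]_x (h k x)%:E)%E).
by rewrite /mean /Rintegral fineK.
Qed.

End mean.

(** The sum is the integer part of [y]; written as a sum of indicators of
    superlevel sets it approximates a function by simple functions. *)
Lemma count_layers (R : realType) (y : R) (k : nat) : 0 <= y <= k%:R ->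
  `|y - \sum_(i < k) (i.+1%:R <= y)%R%:R| <= 1.
Proof.
elim: k => [|k IHk] /andP[y0].
  move=> yk; rewrite big_ord0 subr0.
  by rewrite (_ : y = 0) ?normr0 ?ler01//; apply/eqP; rewrite eq_le yk y0.
move=> yk1; rewrite big_ord_recr/=.
have [yk|ky] := leP y k%:R.
  rewrite [(k.+1%:R <= y)%R]lt_geF ?addr0; last first.
    by rewrite (le_lt_trans yk)// ltr_nat.
  by apply: IHk; rewrite y0.
rewrite (eq_bigr (fun=> 1)) => [|i _]; last first.
  by rewrite (le_trans _ (ltW ky))// ler_nat ltn_ord.
rewrite sumr_const card_ord.
have [ky1|yk1'] := leP k.+1%:R y.
  rewrite (_ : y = k.+1%:R) ?natr1 ?subrr ?normr0 ?ler01//.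
  by apply/eqP; rewrite eq_le yk1 ky1.
rewrite addr0 ger0_norm ?subr_ge0 ?(ltW ky)//.
by move: yk1; rewrite -natr1; lra.
Qed.

(** A functional which is linear and continuous for the sup norm on bounded
    measurable functions is determined by its values on indicators, because
    indicators span a dense subspace. *)
Lemma bounded_functional_eq0 (d : measure_display) (T : measurableType d)
    (R : realType) (Lam : (T -> R) -> R) (c : R) :
  (forall f g : T -> R, bounded_measurable f -> bounded_measurable g ->
     Lam (fun x => f x + g x) = Lam f + Lam g) ->
  (forall (r : R) f, bounded_measurable f -> Lam (fun x => r * f x) = r * Lam f) ->
  (forall f (M : R), bounded_measurable f -> (forall x, `|f x| <= M) ->
     `|Lam f| <= c * M) ->
  (forall A, measurable A -> Lam \1_A = 0) ->
  forall f, bounded_measurable f -> Lam f = 0.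
Proof.
move=> LD LZ Lc L0 f bf.
have [mf [M0 fM0]] := bf.
pose M := (Num.truncn `|M0|).+1; have fM x : `|f x| <= M%:R.
  apply: (le_trans (fM0 x)); apply: (le_trans (ler_norm _)).
  exact/ltW/truncnS_gt.
have Lsum (k : nat) (h : nat -> T -> R) : (forall i, bounded_measurable (h i)) ->
    Lam (fun x => \sum_(i < k) h i x) = \sum_(i < k) Lam (h i).
  move=> bh; elim: k => [|k IHk].
    under eq_fun do rewrite big_ord0.
    have := LZ 0 (fun=> 0) (bm_cst _); under eq_fun do rewrite mul0r.
    by rewrite mul0r big_ord0.
  under eq_fun do rewrite big_ord_recr/=.
  by rewrite LD ?IHk ?big_ord_recr//; exact: bm_sum.
have c0 : 0 <= c.
  have := Lc (fun=> 1) 1 (bm_cst _); rewrite mulr1 => h.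
  by rewrite (le_trans _ (h _))// => x; rewrite normr1.
apply/eqP; rewrite -normr_le0; apply/ler_addgt0Pl => e e0; rewrite addr0.
pose N := (Num.truncn (c / e)).+1; have N0 : (0 < N%:R :> R) by rewrite ltr0n.
have cNe : c / N%:R <= e.
  rewrite ler_pdivrMr// mulrC -ler_pdivrMr//.
  exact/ltW/truncnS_gt.
pose A i := [set x | i.+1%:R <= N%:R * (f x + M%:R)].
have mA i : measurable (A i).
  have mg : measurable_fun [set: T] (fun x => N%:R * (f x + M%:R)).
    by apply: measurable_funM => //; exact: measurable_funD.
  have := mg measurableT _ (measurable_itv `[i.+1%:R, +oo[); rewrite setTI.
  by congr measurable; apply/seteqP; split => x; rewrite /A/= in_itv/= andbT.
pose g x : R := N%:R^-1 * (\sum_(i < (N * (2 * M))%N) \1_(A i) x) + (- M%:R) * (\1_[set: T] x).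
have bS : bounded_measurable (fun x => \sum_(i < (N * (2 * M))%N) (\1_(A i) x : R)).
  by apply: bm_sum => i; exact: bm_indic.
have bg : bounded_measurable g.
  apply: bmD; first exact: bmZ.
  by apply: bmZ; exact: bm_indic.
have Lg : Lam g = 0.
  rewrite /g LD; last 2 first.
  - exact: bmZ.
  - by apply: bmZ; exact: bm_indic.
  rewrite LZ// LZ; last exact: bm_indic.
  rewrite L0// mulr0 addr0 (Lsum _ (fun i => \1_(A i))); last by move=> i; exact: bm_indic.
  by rewrite big1 ?mulr0// => i _; rewrite L0.
have fg x : `|f x - g x| <= N%:R^-1.
  rewrite /g indicT mulr1.
  under eq_bigr do rewrite indicE.
  have /andP[f1 f2] : - M%:R <= f x <= M%:R by rewrite -ler_norml.
  have := @count_layers R (N%:R * (f x + M%:R)) (N * (2 * M)).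
  rewrite natrM natrM => /(_ _)/wrap[].
    apply/andP; split; last by rewrite ler_pM2l//; lra.
    by apply: mulr_ge0; [exact: ltW | lra].
  rewrite (eq_bigr (fun i : 'I__ => (x \in A i)%:R : R)) => [h|i _]; last first.
    congr (nat_of_bool _)%:R; apply/idP/idP; first by move=> ?; rewrite inE.
    by rewrite inE.
  have -> : f x - (N%:R^-1 * \sum_(i < N * (2 * M)) (x \in A i)%:R + - M%:R) =
      N%:R^-1 * (N%:R * (f x + M%:R) - \sum_(i < N * (2 * M)) (x \in A i)%:R).
    by field; rewrite gt_eqF.
  by rewrite normrM ger0_norm ?invr_ge0 ?ler0n// ler_piMr// invr_ge0 ler0n.
have -> : Lam f = Lam (fun x => f x - g x).
  under eq_fun do rewrite -mulN1r.
  by rewrite LD ?LZ ?Lg ?mulr0 ?addr0//; exact: bmZ.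
apply: (le_trans _ cNe); apply: Lc => //; exact: bmB.
Qed.

(** * The Markov property and the forward equation *)

Lemma measurable_coordinate (y : int) (b : bool) :
  measurable [set eta : conf | eta y = b].
Proof. by apply: sub_sigma_algebra; exists y, b. Qed.

Lemma measurable_pattern (s : seq int) (p : seq bool) :
  measurable [set eta : conf | map eta s = p].
Proof.
elim: s p => [|y s IHs] [|b p].
- by rewrite (_ : [set _ | _] = setT)//; apply/seteqP; split.
- by rewrite (_ : [set _ | _] = set0)//; apply/seteqP; split => e.
- by rewrite (_ : [set _ | _] = set0)//; apply/seteqP; split => e.
rewrite (_ : [set _ | _] = [set eta : conf | eta y = b] `&`
                           [set eta : conf | map eta s = p]).
  by apply: measurableI => //; exact: measurable_coordinate.
by apply/seteqP; split => e /= [] -> ->.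
Qed.

Lemma index_nth_map (e : conf) (s : seq int) (y : int) : y \in s ->
  nth false (map e s) (index y s) = e y.
Proof. by move=> ys; rewrite (nth_map 0) ?index_mem// nth_index. Qed.

(** Such a function depends on the state through one of countably many
    patterns: a position, and values on the finitely many coordinates attached
    to it. *)
Lemma measurable_local (R : realType) (f : state -> R) :
  (forall x, exists s : seq int, forall e e' : conf,
     (forall y, y \in s -> e y = e' y) -> f (e, x) = f (e', x)) ->
  measurable_fun [set: state] f.
Proof.
move=> /choice[s sf] _ B mB; rewrite setTI.
pose ext (i : int * seq bool) : conf := fun y => nth false i.2 (index y (s i.1)).
pose C (i : int * seq bool) : set state :=
  [set z : state | z.2 = i.1 /\ map (z.1 : conf) (s i.1) = i.2].
have mC i : measurable (C i).
  rewrite (_ : C i = (snd @^-1` [set i.1]) `&`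
                     (fst @^-1` [set e : conf | map e (s i.1) = i.2])).
    apply: measurableI.
      by rewrite -[X in measurable X]setTI; exact: measurable_snd.
    rewrite -[X in measurable X]setTI; apply: measurable_fst => //.
    exact: measurable_pattern.
  by [].
have -> : f @^-1` B =
    \bigcup_(i : int * seq bool) (if `[< B (f (ext i, i.1)) >] then C i else set0).
  have fC i z : C i z -> f z = f (ext i, i.1).
    case: z => e x [/= xi ei]; rewrite xi; apply: sf => y ys.
    by rewrite /ext -ei index_nth_map.
  apply/seteqP; split => [z Bz|z [i _]].
    have Cz : C (z.2, map (z.1 : conf) (s z.2)) z by [].
    exists (z.2, map (z.1 : conf) (s z.2)) => //.
    by case: asboolP => // -[]; rewrite -(fC _ _ Cz).
  by case: asboolP => // Bi Ci; rewrite /preimage/= (fC _ _ Ci).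
apply: countable_bigcupT_measurable; first exact: countableP.
by move=> i; case: ifP.
Qed.

Lemma local_measurable (R : realType) (f : state -> R) :
  local f -> measurable_fun [set: state] f.
Proof. by move=> [s sf]; apply: measurable_local => x; exists s => e e'; exact: sf. Qed.

Lemma local_bm (R : realType) (f : state -> R) :
  local f -> (exists M : R, forall z, `|f z| <= M) -> bounded_measurable f.
Proof. by move=> lf bf; split => //; exact: local_measurable. Qed.

Lemma pker_setT (R : realType) (d : measure_display) (S : measurableType d)
  (k : R.-pker S ~> S) (z : S) : k z [set: S] = 1%E.
Proof. exact: prob_kernel. Qed.

Section kernel_mean.
Context {R : realType} {d : measure_display} {S : measurableType d}.
Variable k : R.-pker S ~> S.

Lemma measurable_kernel_mean (f : S -> R) : bounded_measurable f ->
  measurable_fun [set: S] (fun z => mean (k z) f).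
Proof.
move=> bf; have [mf [M fM]] := bf.
have M0 z : 0 <= f z + M by have := fM z; rewrite ler_norml => /andP[]; lra.
have bfM : bounded_measurable (fun z => f z + M) by apply: bmD => //; exact: bm_cst.
have -> : (fun z => mean (k z) f) =
    (fun z => fine (\int[k z]_w (f w + M)%:E)%E - M).
  apply/funext => z; rewrite -(mean_EFin (pker_setT k z) bfM)/=.
  rewrite (meanD (pker_setT k z)) ?(mean_cst (pker_setT k z)) ?addrK//.
  exact: bm_cst.
apply: measurable_funB; last exact: measurable_cst.
apply: measurableT_comp => //.
apply: measurable_fun_integral_kernel.
- by move=> U mU; exact: measurable_kernel.
- by move=> z; rewrite lee_fin.
- by apply/measurable_EFinP; case: bfM.
Qed.

Lemma bm_kernel_mean (f : S -> R) : bounded_measurable f ->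
  bounded_measurable (fun z => mean (k z) f).
Proof.
move=> bf; have [_ [M fM]] := bf; split; first exact: measurable_kernel_mean.
by exists M => z; exact: (ler_norm_mean (pker_setT k z)).
Qed.

End kernel_mean.

Section markov_functions.
Context (R : realType) (d : measure_display) (S : measurableType d).
Context (d' : measure_display) (T : measurableType d') (P : probability T R).
Variables (Z : R -> T -> S) (K : R -> R.-pker S ~> S).
Hypothesis mZ : forall t : R, 0 <= t -> measurable_fun [set: T] (Z t).
Hypothesis KP : markov_property P Z K.

Let P1 : P [set: T] = 1%E. Proof. exact: probability_setT. Qed.

Lemma bm_process (t : R) (f : S -> R) : 0 <= t -> bounded_measurable f ->
  bounded_measurable (fun w => f (Z t w)).
Proof. by move=> t0 bf; apply: (bm_comp (mZ t0) bf). Qed.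

(** For indicators this is [markov_property]; both sides are bilinear and
    continuous in [(g, f)] for the sup norm. *)
Lemma markov_mean (r s t : R) (g f : S -> R) :
  0 <= r <= s -> 0 <= t -> bounded_measurable g -> bounded_measurable f ->
  mean P (fun w => g (Z r w) * f (Z (s + t) w)) =
  mean P (fun w => g (Z r w) * mean (K t (Z s w)) f).
Proof.
move=> /andP[r0 rs] t0; have s0 := le_trans r0 rs; have st0 := addr_ge0 s0 t0.
have K1 z := pker_setT (K t) z.
pose Lam (u v : S -> R) := mean P (fun w => u (Z r w) * v (Z (s + t) w)) -
  mean P (fun w => u (Z r w) * mean (K t (Z s w)) v).
have bl (u v : S -> R) : bounded_measurable u -> bounded_measurable v ->
    bounded_measurable (fun w => u (Z r w) * v (Z (s + t) w)).
  by move=> bu bv; apply: bmM; [exact: (bm_process r0 bu)|exact: (bm_process st0 bv)].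
have br (u v : S -> R) : bounded_measurable u -> bounded_measurable v ->
    bounded_measurable (fun w => u (Z r w) * mean (K t (Z s w)) v).
  move=> bu bv; apply: bmM; first exact: (bm_process r0 bu).
  exact: (bm_process s0 (bm_kernel_mean (K t) bv)).
have Lam_bound (u v : S -> R) (M N : R) : bounded_measurable u -> bounded_measurable v ->
    (forall z, `|u z| <= M) -> (forall z, `|v z| <= N) ->
    `|Lam u v| <= 2 * M * N.
  move=> bu bv uM vN.
  apply: (le_trans (ler_normB _ _)); rewrite -mulrA mulrDl mul1r; apply: lerD.
    by apply: ler_norm_mean => //; [exact: bl | move=> w; rewrite normrM ler_pM].
  apply: ler_norm_mean => //; first exact: br.
  by move=> w; rewrite normrM ler_pM//; exact: ler_norm_mean.
have Lam_ind (A B : set S) : measurable A -> measurable B -> Lam \1_A \1_B = 0.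
  move=> mA mB; apply/eqP; rewrite subr_eq0; apply/eqP/EFin_inj.
  have mZA : measurable (Z r @^-1` A) by rewrite -[X in measurable X]setTI; exact: mZ.
  have mZB : measurable (Z (s + t) @^-1` B).
    by rewrite -[X in measurable X]setTI; exact: mZ.
  have -> : mean P (fun w => \1_A (Z r w) * \1_B (Z (s + t) w)) =
      mean P \1_(Z r @^-1` A `&` Z (s + t) @^-1` B).
    by apply: eq_mean => w; rewrite indicI/= !indicE.
  rewrite mean_indic//; last exact: measurableI.
  have ZrA : natural_filtration Z s (Z r @^-1` A).
    by apply: sub_sigma_algebra; exists r, A; rewrite r0 rs.
  apply: (etrans (KP s0 t0 ZrA mB)).
  rewrite mean_EFin//; last by apply: br; exact: bm_indic.
  rewrite [LHS]integral_mkcond; congr integral; apply/funext => w.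
  rewrite EFinM mean_indic//= /patch /= indicE.
  rewrite (_ : (w \in Z r @^-1` A) = (Z r w \in A)); last first.
    by apply/idP/idP; rewrite !inE.
  by case: ifP => _; rewrite ?mul1e ?mul0e.
move=> bg bf; apply/eqP; rewrite -subr_eq0; apply/eqP; rewrite -/(Lam g f).
have [_ [M gM]] := bg; have [_ [N fN]] := bf.
have LamDl (f' g1 g2 : S -> R) : bounded_measurable f' -> bounded_measurable g1 ->
    bounded_measurable g2 -> Lam (fun x => g1 x + g2 x) f' = Lam g1 f' + Lam g2 f'.
  move=> bf' b1 b2; rewrite /Lam.
  under eq_fun do rewrite mulrDl; rewrite meanD//; try exact: bl.
  under [X in _ - mean P X]eq_fun do rewrite mulrDl.
  by rewrite meanD//; try exact: br; ring.
have LamZl (f' : S -> R) (a : R) (g1 : S -> R) : bounded_measurable f' -> bounded_measurable g1 ->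
    Lam (fun x => a * g1 x) f' = a * Lam g1 f'.
  move=> bf' b1; rewrite /Lam.
  under eq_fun do rewrite -mulrA; rewrite meanZ//; last exact: bl.
  under [X in _ - mean P X]eq_fun do rewrite -mulrA.
  by rewrite meanZ//; [ring | exact: br].
apply: (@bounded_functional_eq0 _ _ _ (Lam ^~ f) (2 * N)) => //.
- by move=> g1 g2; exact: LamDl.
- by move=> a g1; exact: LamZl.
- by move=> g1 M' b1 g1M; rewrite mulrAC; exact: Lam_bound.
move=> A mA; have bA := bm_indic mA.
apply: (@bounded_functional_eq0 _ _ _ (Lam \1_A) 2) => //.
- move=> f1 f2 b1 b2; rewrite /Lam.
  under eq_fun do rewrite mulrDr; rewrite meanD//; try exact: bl.
  under [X in _ - mean P X]eq_fun do rewrite (meanD (K1 _))// mulrDr.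
  by rewrite meanD//; try exact: br; ring.
- move=> a f1 b1; rewrite /Lam.
  under eq_fun do rewrite mulrCA; rewrite meanZ//; last exact: bl.
  under [X in _ - mean P X]eq_fun do rewrite (meanZ (K1 _))// mulrCA.
  by rewrite meanZ//; [ring | exact: br].
- move=> f1 M' b1 f1M; rewrite -[2]mulr1; apply: Lam_bound => //.
  by move=> z; rewrite indicE; case: (_ \in _); rewrite ?normr1 ?normr0.
by move=> B mB; exact: Lam_ind.
Qed.

Variables (L : (S -> R) -> S -> R) (f : S -> R).
Hypothesis bf : bounded_measurable f.
Hypothesis gen : generates_on K L f.

(** [L f] is a uniform limit of the bounded measurable functions
    [(K_t f - f) / t]. *)
Lemma bm_generator : bounded_measurable (L f).
Proof.
pose q (h : R) z := h^-1 * (mean (K h z) f - f z).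
have bq h : bounded_measurable (q h).
  by apply: bmZ; apply: bmB => //; exact: bm_kernel_mean.
have near_q (e : R) : 0 < e -> \forall n \near \oo, forall z,
    `|q n.+1%:R^-1 z - L f z| < e.
  move=> e0; have [h0 /= h00 Hh] := gen e0.
  have [n0 _ Hn] := near_infty_natSinv_lt (PosNum h00).
  exists n0 => // n /= n0n z; apply: Hh; last by rewrite invr_gt0 ltr0n.
  rewrite /ball_/= sub0r normrN ger0_norm ?invr_ge0 ?ler0n//.
  exact: Hn.
split.
  apply: (measurable_fun_cvg (h := fun n => q n.+1%:R^-1)).
    by move=> n; case: (bq n.+1%:R^-1).
  move=> z _; apply/cvgrPdist_lt => e e0; near=> n.
  rewrite distrC; move: z; near: n; exact: near_q.
have [n0 _ /(_ n0 (leqnn _)) Hn] := near_q 1 ltr01.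
have [_ [M qM]] := bq n0.+1%:R^-1.
exists (M + 1) => z; rewrite -[L f z](subKr (q n0.+1%:R^-1 z)).
by rewrite (le_trans (ler_normB _ _))// lerD// ltW.
Unshelve. all: by end_near. Qed.

(** Kolmogorov's forward equation over one small time step [h], with an error
    [h * e] that is uniform in the current time [s] and in the past factor
    [g (Z r)]. *)
Lemma forward_step (e : R) : 0 < e -> exists2 h0 : R, 0 < h0 &
  forall (h r s : R) (g : S -> R) (M : R), 0 < h < h0 -> 0 <= r <= s ->
    bounded_measurable g -> (forall z, `|g z| <= M) ->
    `|mean P (fun w => g (Z r w) * f (Z (s + h) w)) -
      mean P (fun w => g (Z r w) * f (Z s w)) -
      h * mean P (fun w => g (Z r w) * L f (Z s w))| <= M * (h * e).
Proof.
move=> e0; have [h0 /= h00 Hh] := gen e0; exists h0 => //.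
move=> h r s g M /andP[h1 h2] /andP[r0 rs] bg gM.
have s0 := le_trans r0 rs.
have bL := bm_generator; have bK := bm_kernel_mean (K h) bf.
have bg' := bm_process r0 bg.
rewrite markov_mean ?r0 ?(ltW h1)//.
have b1 : bounded_measurable (fun w => g (Z r w) * mean (K h (Z s w)) f).
  by apply: bmM => //; exact: (bm_process s0 bK).
have b2 : bounded_measurable (fun w => g (Z r w) * f (Z s w)).
  by apply: bmM => //; exact: (bm_process s0).
have b3 : bounded_measurable (fun w => g (Z r w) * L f (Z s w)).
  by apply: bmM => //; exact: (bm_process s0).
rewrite -meanB// -meanZ// -meanB//; [|exact: bmB|exact: bmZ].
apply: ler_norm_mean => //; first by apply: bmB; [exact: bmB|exact: bmZ].
move=> w; set z := Z s w.
rewrite (_ : _ - _ = g (Z r w) * (h * (h^-1 * (mean (K h z) f - f z) - L f z))).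
  rewrite normrM ler_pM// normrM gtr0_norm// ler_pM2l//; apply/ltW.
  by apply: Hh => //; rewrite /ball_/= sub0r normrN gtr0_norm.
by field; rewrite gt_eqF.
Qed.

End markov_functions.

(** * Second moment of an additive functional *)

Lemma sqr_sum_ord (R : comPzRingType) (a : nat -> R) (k : nat) :
  (\sum_(i < k) a i) ^+ 2 =
  \sum_(i < k) (a i ^+ 2 + 2 * (a i * \sum_(i.+1 <= j < k) a j)).
Proof.
elim: k => [|k IHk]; first by rewrite !big_ord0 expr2 mul0r.
rewrite big_ord_recr/= [RHS]big_ord_recr/= [in RHS]big_geq// !mulr0 addr0.
under [in RHS]eq_bigr => i _ do rewrite big_nat_recr//= mulrDr mulrDr addrA.
rewrite big_split/= -IHk sqrrD -mulr_sumr -mulr_suml mulr_natl.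
by rewrite -addrA.
Qed.

Section additive_functional.
Context (R : realType) (d : measure_display) (S : measurableType d).
Context (d' : measure_display) (T : measurableType d') (P : probability T R).
Variables (Z : R -> T -> S) (K : R -> R.-pker S ~> S).
Hypothesis mZ : forall t : R, 0 <= t -> measurable_fun [set: T] (Z t).
Hypothesis KP : markov_property P Z K.
Variables (L : (S -> R) -> S -> R) (f : S -> R).
Hypothesis bf : bounded_measurable f.
Hypothesis gen : generates_on K L f.

Let P1 : P [set: T] = 1%E. Proof. exact: probability_setT. Qed.

(** [L f (Z s) ds] is, up to a martingale increment, the increment of [f (Z s)].
    Hence the correlations of a term with the sum of all later ones
    telescope, and the second moment grows linearly in time. *)
Lemma additive_functional_moment (F0 G0 e : R) : 0 < e ->
  (forall z, `|f z| <= F0) -> (forall z, `|L f z| <= G0) ->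
  exists2 h0 : R, 0 < h0 & forall (h : R) (k : nat), 0 < h < h0 ->
    mean P (fun w => (\sum_(j < k) L f (Z (j.+1%:R * h) w)) ^+ 2) <=
    k%:R * G0 ^+ 2 + 2 * k%:R * (2 * G0 * F0 / h + k%:R * (G0 * e)).
Proof.
move=> e0 fF LG; have [h0 h00 Hh] := forward_step mZ KP bf gen e0.
exists h0 => // h k h0h; have /andP[hp _] := h0h.
have bL := bm_generator bf gen.
pose G (j : nat) w := L f (Z (j.+1%:R * h) w).
have tp j : 0 <= j.+1%:R * h :> R by rewrite mulr_ge0// ltW.
have bG j : bounded_measurable (G j) by exact: (bm_process mZ (tp j) bL).
have bGs i m : bounded_measurable (fun w => \sum_(i <= j < m) G j w).
  by apply: bm_sum.
have bF j : bounded_measurable (fun w => f (Z (j.+1%:R * h) w)).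
  exact: (bm_process mZ (tp j) bf).
have GG j w : `|G j w| <= G0 by exact: LG.
have G00 : 0 <= G0.
  by rewrite (le_trans _ (LG point)).
pose U i j := mean P (fun w => G i w * f (Z (j.+1%:R * h) w)).
have tele i m : (i < m)%N ->
    `|h * mean P (fun w => G i w * \sum_(i.+1 <= j < m) G j w) -
      (U i m - U i i.+1)| <= (m - i.+1)%:R * (G0 * (h * e)).
  elim: m => // m IHm; rewrite ltnS leq_eqVlt => /predU1P[->|im].
    under eq_fun do rewrite big_geq// mulr0.
    by rewrite (mean_cst P1) subrr mulr0 subr0 normr0 subnn mul0r.
  under eq_fun do rewrite big_nat_recr//= mulrDr.
  rewrite (meanD P1); [|exact: bmM|exact: bmM].
  have := @Hh h (i.+1%:R * h) (m.+1%:R * h) (L f) G0 h0h _ bL LG.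
  rewrite tp ler_pM2r// ler_nat ltnS (ltnW im).
  rewrite -[X in m.+1%:R * h + X]mul1r -mulrDl natr1 => /(_ isT).
  rewrite -/(U i m.+1) -/(U i m).
  move: (IHm im); rewrite subSn// -[(m - i.+1).+1%:R]natr1 mulrDl mul1r.
  set A := mean P _; set B := mean P (fun w => G i w * G m w).
  move=> IH step.
  have {}step : `|U i m.+1 - U i m - h * B| <= G0 * (h * e) := step.
  rewrite (_ : h * (A + B) - _ = (h * A - (U i m - U i i.+1)) -
    (U i m.+1 - U i m - h * B)); last by ring.
  exact: le_trans (ler_normB _ _) (lerD IH step).
have pair_bound i : (i < k)%N ->
    mean P (fun w => G i w * \sum_(i.+1 <= j < k) G j w) <=
    2 * G0 * F0 / h + k%:R * (G0 * e).
  move=> ik; rewrite -(ler_pM2l hp).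
  have Ub j : `|U i j| <= G0 * F0.
    apply: (ler_norm_mean P1); first exact: bmM.
    by move=> w; rewrite normrM ler_pM.
  have := tele i k ik; have := Ub k; have := Ub i.+1.
  have kik : (k - i.+1)%:R * (G0 * (h * e)) <= k%:R * (G0 * (h * e)).
    rewrite ler_wpM2r ?ler_nat ?leq_subr// mulr_ge0// mulr_ge0 ?ltW//.
  set A := mean P _ => U1 U2 tl.
  rewrite (_ : h * (_ + _) = 2 * (G0 * F0) + k%:R * (G0 * (h * e))); last first.
    by field; rewrite gt_eqF.
  move: U1 U2 (le_trans tl kik); rewrite !ler_norml.
  by move=> /andP[? ?] /andP[? ?] /andP[? ?]; lra.
under eq_fun do rewrite (sqr_sum_ord (G ^~ _)).
have b1 i : bounded_measurable (fun w => G i w ^+ 2 +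
    2 * (G i w * \sum_(i.+1 <= j < k) G j w)).
  by apply: bmD; [under eq_fun do rewrite expr2; exact: bmM|apply: bmZ; exact: bmM].
rewrite (mean_sum P1)//.
have -> : k%:R * G0 ^+ 2 + 2 * k%:R * (2 * G0 * F0 / h + k%:R * (G0 * e)) =
    \sum_(i < k) (G0 ^+ 2 + 2 * (2 * G0 * F0 / h + k%:R * (G0 * e))).
  by rewrite sumr_const card_ord -[RHS]mulr_natl; ring.
apply: ler_sum => i _; rewrite (meanD P1); last 2 first.
- by under eq_fun do rewrite expr2; exact: bmM.
- by apply: bmZ; exact: bmM.
apply: lerD.
  apply: le_trans (ler_norm _) _; apply: (ler_norm_mean P1).
    by under eq_fun do rewrite expr2; exact: bmM.
  by move=> w; rewrite normrX lerXn2r ?nnegrE.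
by rewrite (meanZ P1) ?ler_pM2l ?pair_bound//; exact: bmM.
Qed.

End additive_functional.

(** * The generator on three families of functions *)

Definition swap_sites (y x : int) : int :=
  if x == y then y + 1 else if x == y + 1 then y else x.

Lemma exchangeE (y : int) (e : conf) (x : int) : exchange y e x = e (swap_sites y x).
Proof. by rewrite /exchange /swap_sites; case: eqP => // _; case: eqP. Qed.

Lemma swap_sitesK (y : int) : involutive (swap_sites y).
Proof.
move=> x; rewrite /swap_sites; have [->|xy] := eqVneq x y.
  by rewrite eqxx; case: eqP => //; lia.
by have [->|xy1] := eqVneq x (y + 1); rewrite ?eqxx// (negPf xy) (negPf xy1).
Qed.

Definition product_obs (R : realType) (g : bool -> R) (s : seq int) (z : state) : R :=
  \prod_(y <- s) g ((z.1 : conf) y).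

(** The sum of [Ljoint] over all exchanges reduces to the bonds [y, y + 1]
    that touch a given finite set of sites. *)
Definition touching_bonds (s : seq int) : seq int :=
  undup (s ++ [seq x - 1 | x <- s]).

Lemma size_touching_bonds (s : seq int) :
  (size (touching_bonds s) <= 2 * size s)%N.
Proof.
by rewrite (leq_trans (size_undup _))// size_cat size_map mul2n -addnn.
Qed.

Lemma swap_sites_id (s : seq int) (y x : int) :
  y \notin touching_bonds s -> x \in s -> swap_sites y x = x.
Proof.
rewrite mem_undup mem_cat negb_or => /andP[ys ys1] xs; rewrite /swap_sites.
case: eqP => [xy|_]; first by rewrite -xy xs in ys.
case: eqP => // xy; case/negP: ys1; apply/mapP; exists x => //.
by rewrite xy addrK.
Qed.

Lemma sum_bonds (R : realType) (s : seq int) (f : conf -> R) (e : conf) :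
  (forall e' : conf, (forall y, y \in s -> e' y = e y) -> f e' = f e) ->
  \sum_(y \in [set: int]) (f (exchange y e) - f e) =
  \sum_(y <- touching_bonds s) (f (exchange y e) - f e).
Proof.
move=> fs; rewrite (fsbigE (touching_bonds s)) ?undup_uniq//.
  by apply: eq_bigl => y; rewrite in_setT.
move=> y _ ys /=; rewrite fs ?subrr// => x xs.
by rewrite exchangeE (swap_sites_id ys).
Qed.

Section product_observables.
Context (R : realType) (lambda : R) (g : bool -> R) (b : R).
Hypothesis gb : forall x, `|g x| <= b.

Lemma norm_product_obs (s : seq int) (z : state) :
  `|product_obs g s z| <= b ^+ size s.
Proof.
rewrite /product_obs normr_prod; elim: s => [|y s IHs]; first by rewrite big_nil.
by rewrite big_cons exprS ler_pM// prodr_ge0.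
Qed.

Lemma local_product_obs (s : seq int) : local (product_obs g s).
Proof.
by exists s => e e' x ee'; apply: eq_big_seq => y ys /=; rewrite ee'.
Qed.

Lemma product_obs_bm (s : seq int) : bounded_measurable (product_obs g s).
Proof.
apply: local_bm; first exact: local_product_obs.
by exists (b ^+ size s) => z; exact: norm_product_obs.
Qed.

Lemma Ljoint_product_obs (s : seq int) (z : state) :
  Ljoint lambda (product_obs g s) z =
  \sum_(y <- touching_bonds s)
    (product_obs g (map (swap_sites y) s) z - product_obs g s z).
Proof.
case: z => e x; rewrite /Ljoint.
rewrite (_ : product_obs g s (e, x + 1) + _ - _ = 0) ?mulr0 ?addr0; last first.
  by rewrite /product_obs/=; ring.
rewrite (sum_bonds (s := s) (f := fun e => product_obs g s (e, x))); last first.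
  by move=> e' ee'; apply: eq_big_seq => y ys /=; rewrite ee'.
apply: eq_bigr => y _; congr (_ - _); rewrite /product_obs big_map.
by apply: eq_bigr => u _; rewrite /= exchangeE.
Qed.

End product_observables.

Section walk_spread.
Context (R : realType).

(** The second moment of the walk, truncated at the level [M ^ 2] to make it a
    bounded function, and normalised. *)
Definition walk_spread (M : R) (z : state) : R :=
  Num.min (z.2%:~R ^+ 2) (M ^+ 2) / M ^+ 2.

Lemma walk_spread_ge0 (M : R) (z : state) : 0 <= walk_spread M z.
Proof. by rewrite divr_ge0 ?sqr_ge0// le_min !sqr_ge0. Qed.

Lemma walk_spread_le1 (M : R) (z : state) : 0 < M -> walk_spread M z <= 1.
Proof.
by move=> M0; rewrite ler_pdivrMr ?exprn_gt0// mul1r ge_min lexx orbT.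
Qed.

Lemma walk_spread_far (M : R) (z : state) : 0 < M -> M <= `|z.2%:~R| ->
  walk_spread M z = 1.
Proof.
move=> M0 Mz; rewrite /walk_spread min_r ?divff ?gt_eqF ?exprn_gt0//.
by rewrite -[leRHS]real_normK ?num_real// lerXn2r// ?nnegrE// ltW.
Qed.

Lemma local_walk_spread (M : R) : local (walk_spread M).
Proof. by exists [::]. Qed.

Lemma norm_walk_spread (M : R) : 0 < M -> forall z, `|walk_spread M z| <= 1.
Proof. by move=> M0 z; rewrite ger0_norm ?walk_spread_ge0// walk_spread_le1. Qed.

Lemma jump_rate01 (lambda : R) (e : conf) (x : int) : 0 <= lambda <= 1 ->
  0 <= (1 - lambda) * (e x)%:R + (1 - (e x)%:R) <= 1.
Proof.
by move=> /andP[? ?]; case: (e x) => /=; apply/andP; split; lra.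
Qed.

(** The truncation is concave where it is not quadratic, so that its discrete
    Laplacian stays below that of the square. *)
Lemma Ljoint_walk_spread (lambda M : R) (z : state) : 0 <= lambda <= 1 -> 0 < M ->
  Ljoint lambda (walk_spread M) z <= 2 / M ^+ 2.
Proof.
move=> lambda01 M0; case: z => e x; rewrite /Ljoint fsbig1 ?add0r; last first.
  by move=> y _; rewrite subrr.
have M2 : 0 < M ^+ 2 by rewrite exprn_gt0.
have /andP[c0 c1] := jump_rate01 e x lambda01; set c := _ + (1 - _) in c0 c1 *.
suff D : walk_spread M (e, x + 1) + walk_spread M (e, x - 1) -
    2 * walk_spread M (e, x) <= 2 / M ^+ 2.
  have [D0|D0] := leP 0 (walk_spread M (e, x + 1) + walk_spread M (e, x - 1) -
    2 * walk_spread M (e, x)).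
    by rewrite (le_trans _ D)// ler_piMl.
  by apply: (@le_trans _ _ 0); [exact: mulr_ge0_le0 c0 (ltW D0)|rewrite divr_ge0// ltW].
rewrite /walk_spread /= mulrA -mulrDl -mulrBl ler_pM2r ?invr_gt0//.
set y : R := x%:~R; rewrite rmorphB rmorphD /= -/y.
have m1 a : Num.min a (M ^+ 2) <= a by rewrite ge_min lexx.
have m2 a : Num.min a (M ^+ 2) <= M ^+ 2 by rewrite ge_min lexx orbT.
have := m1 ((y + 1) ^+ 2); have := m1 ((y - 1) ^+ 2).
have := m2 ((y + 1) ^+ 2); have := m2 ((y - 1) ^+ 2).
by case: (leP (y ^+ 2) (M ^+ 2)) => _; nra.
Qed.

End walk_spread.

(** Summing a discrete Laplacian over [window m] leaves its outward gradients at the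
    two ends of [-m, m]; summing these over the windows in [triangle m] leaves
    [u m + u (- m) - 2 u 0], and summing over the triangles in [pyramid m] leaves
    the comparison of [u 0] with the sum of [u] over [annulus m]. The lists are
    multisets: the multiplicity of [y] in [pyramid m] is the piecewise quadratic
    Green function of this comparison. *)
Fixpoint window (m : nat) : seq int :=
  if m is m'.+1 then m%:Z :: - m%:Z :: window m' else [:: 0].

Fixpoint triangle (m : nat) : seq int :=
  if m is m'.+1 then window m' ++ triangle m' else [::].

Fixpoint pyramid (m : nat) : seq int :=
  if m is m'.+1 then triangle m ++ pyramid m' else [::].

Fixpoint annulus (m : nat) : seq int :=
  if m is m'.+1 then m%:Z :: - m%:Z :: annulus m' else [::].

Lemma size_window m : size (window m) = (2 * m).+1.
Proof. by elim: m => //= m ->; lia. Qed.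

Lemma size_triangle m : size (triangle m) = (m ^ 2)%N.
Proof. by elim: m => //= m IHm; rewrite size_cat size_window IHm; lia. Qed.

Lemma pyramidS m : pyramid m.+1 = triangle m.+1 ++ pyramid m.
Proof. by []. Qed.

Lemma size_pyramid m : (size (pyramid m) <= m ^ 3)%N.
Proof.
elim: m => // m IHm; rewrite pyramidS size_cat size_triangle; nia.
Qed.

Lemma size_annulus m : size (annulus m) = (2 * m)%N.
Proof. by elim: m => //= m ->; lia. Qed.

Lemma mem_window (m : nat) (x : int) : (x \in window m) = (`|x| <= m%:Z).
Proof.
elim: m => [|m IHm]; first by rewrite inE; lia.
by rewrite /= !inE IHm; lia.
Qed.

Lemma mem_annulus (m : nat) (x : int) : (x \in annulus m) = (x != 0) && (`|x| <= m%:Z).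
Proof.
elim: m => [|m IHm]; first by rewrite in_nil; lia.
by rewrite /= !inE IHm; lia.
Qed.

Lemma uniq_annulus (m : nat) : uniq (annulus m).
Proof.
elim: m => //= m ->; rewrite !inE !mem_annulus; lia.
Qed.

Definition laplacian (R : realType) (u : int -> R) (x : int) : R :=
  u (x + 1) + u (x - 1) - 2 * u x.

Lemma sum_window_laplacian (R : realType) (u : int -> R) (m : nat) :
  \sum_(z <- window m) laplacian u z =
  u m.+1%:Z - u m%:Z + (u (- m.+1%:Z) - u (- m%:Z)).
Proof.
elim: m => [|m IHm] /=.
  by rewrite big_seq1 /laplacian add0r sub0r oppr0; ring.
rewrite !big_cons IHm /laplacian.
rewrite (_ : m.+1%:Z + 1 = m.+2%:Z); last by lia.
rewrite (_ : m.+1%:Z - 1 = m%:Z); last by lia.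
rewrite (_ : - m.+1%:Z + 1 = - m%:Z); last by lia.
rewrite (_ : - m.+1%:Z - 1 = - m.+2%:Z); last by lia.
by ring.
Qed.

Lemma sum_triangle_laplacian (R : realType) (u : int -> R) (m : nat) :
  \sum_(z <- triangle m) laplacian u z = u m%:Z + u (- m%:Z) - 2 * u 0.
Proof.
elim: m => [|m IHm]; first by rewrite big_nil oppr0; ring.
by rewrite big_cat/= IHm sum_window_laplacian; ring.
Qed.

Lemma sum_pyramid_laplacian (R : realType) (u : int -> R) (m : nat) :
  \sum_(z <- pyramid m) laplacian u z =
  \sum_(z <- annulus m) u z - (2 * m)%:R * u 0.
Proof.
elim: m => [|m IHm]; first by rewrite !big_nil mul0r subr0.
rewrite pyramidS big_cat/= -/(triangle m.+1) sum_triangle_laplacian IHm.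
by rewrite [annulus _]/= !big_cons mulnS natrD; ring.
Qed.

Definition occ (R : realType) (e : conf) (y : int) : R := (e y)%:R.

Lemma norm_occ (R : realType) (e : conf) y : `|occ R e y| <= 1.
Proof. by rewrite /occ; case: (e y); rewrite ?normr1 ?normr0. Qed.

Lemma exchange_occ (R : realType) (e : conf) (y : int) :
  \sum_(b \in [set: int]) (occ R (exchange b e) y - occ R e y) =
  laplacian (occ R e) y.
Proof.
rewrite (sum_bonds (s := [:: y]) (f := fun e => occ R e y)); last first.
  by move=> e' ee'; rewrite /occ ee'// inE.
rewrite /touching_bonds /= inE (_ : (y == y - 1) = false); last by lia.
rewrite big_cons big_seq1 /laplacian /occ !exchangeE /swap_sites eqxx.
rewrite (_ : (y == y - 1) = false); last by lia.
by rewrite (_ : y == y - 1 + 1) ?subrK//; ring.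
Qed.

Lemma exchange_occ_sum (R : realType) (e : conf) (s : seq int) :
  \sum_(b \in [set: int]) (\sum_(y <- s) occ R (exchange b e) y - \sum_(y <- s) occ R e y) =
  \sum_(y <- s) laplacian (occ R e) y.
Proof.
rewrite (sum_bonds (s := s) (f := fun e => \sum_(y <- s) occ R e y)); last first.
  by move=> e' ee'; apply: eq_big_seq => y ys; rewrite /occ ee'.
under eq_bigr do rewrite -sumrB.
rewrite exchange_big/=; apply: eq_big_seq => y ys; rewrite -exchange_occ.
rewrite (fsbigE (touching_bonds s)) ?undup_uniq//.
  by apply: eq_bigl => b; rewrite in_setT.
by move=> b _ bs; rewrite /occ exchangeE (swap_sites_id bs)// subrr.
Qed.

Section corrector.
Context (R : realType) (n M : nat).
Hypothesis n0 : (0 < n)%N.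

(** The cutoff in the position makes the corrector local: without it, the
    coordinates on which it depends would move with the walk. *)
Definition corrector (z : state) : R :=
  if `|z.2| <= M%:Z
  then - (2 * n)%:R^-1 * \sum_(y <- pyramid n) occ R z.1 (z.2 + y) else 0.

Definition window_density (z : state) : R :=
  (2 * n)%:R^-1 * \sum_(y <- annulus n) occ R z.1 (z.2 + y).

Lemma local_corrector : local corrector.
Proof.
exists [seq x + y | x <- window M, y <- pyramid n] => e e' x ee'.
rewrite /corrector/=; case: ifP => // xM; congr (_ * _).
apply: eq_big_seq => y yn; rewrite /occ ee'//.
by apply/allpairsP; exists (x, y); rewrite mem_window.
Qed.

Let n2 : (0 : R) < (2 * n)%:R. Proof. by rewrite ltr0n muln_gt0. Qed.

Lemma norm_corrector (z : state) : `|corrector z| <= n%:R ^+ 2.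
Proof.
rewrite /corrector; case: ifP => _; last by rewrite normr0 sqr_ge0.
have a0 : 0 < (2 * n)%:R^-1 :> R by rewrite invr_gt0.
rewrite normrM normrN (gtr0_norm a0) ler_pdivrMl//.
apply: (le_trans (ler_norm_sum _ _ _)).
apply: (@le_trans _ _ (\sum_(y <- pyramid n) 1)).
  by apply: ler_sum => y _; exact: norm_occ.
rewrite big_const_seq count_predT iter_addr_0 -natrX -natrM ler_nat.
have := size_pyramid n; nia.
Qed.

Lemma window_density01 (z : state) : 0 <= window_density z <= 1.
Proof.
apply/andP; split.
  by rewrite mulr_ge0 ?invr_ge0 ?ler0n// sumr_ge0// => y _; exact: ler0n.
rewrite /window_density ler_pdivrMl// mulr1.
apply: (@le_trans _ _ (\sum_(y <- annulus n) 1)).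
  by apply: ler_sum => y _; exact: le_trans (ler_norm _) (norm_occ _ _ _).
by rewrite big_const_seq count_predT iter_addr_0 size_annulus.
Qed.

Lemma pyramid_laplacian_occ (e : conf) (x : int) :
  - (2 * n)%:R^-1 * \sum_(y <- pyramid n) laplacian (occ R e) (x + y) =
  occ R e x - window_density (e, x).
Proof.
have -> : \sum_(y <- pyramid n) laplacian (occ R e) (x + y) =
    \sum_(y <- pyramid n) laplacian (fun y => occ R e (x + y)) y.
  by apply: eq_bigr => y _; rewrite /laplacian !addrA.
rewrite sum_pyramid_laplacian addr0 /window_density/=.
move: (_%:R : R) n2 => N N0; field; exact: lt0r_neq0.
Qed.

(** The Laplacian of the corrector, seen either from the exchanges of the
    environment or from the jumps of the walk. *)
Lemma corrector_exchange (e : conf) (x : int) :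
  \sum_(y \in [set: int]) (corrector (exchange y e, x) - corrector (e, x)) =
  if `|x| <= M%:Z then occ R e x - window_density (e, x) else 0.
Proof.
rewrite /corrector/=; case: ifP => _; last first.
  by rewrite fsbig1// => y _; rewrite subrr.
pose s := [seq x + y | y <- pyramid n].
have sE (u : int -> R) : \sum_(y <- s) u y = \sum_(y <- pyramid n) u (x + y).
  by rewrite big_map.
rewrite -pyramid_laplacian_occ -sE -exchange_occ_sum !(sum_bonds (s := s)
  (f := fun e => \sum_(y <- s) occ R e y)); last first.
  by move=> e' ee'; apply: eq_big_seq => y ys; rewrite /occ ee'.
rewrite [RHS]mulr_sumr (sum_bonds (s := s)
  (f := fun e => - (2 * n)%:R^-1 * \sum_(y <- pyramid n) occ R e (x + y))).
  by apply: eq_bigr => b _; rewrite !sE -mulrBr.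
move=> e' ee'; congr (_ * _); apply: eq_big_seq => y ys; rewrite /occ ee'//.
exact: map_f.
Qed.

Lemma corrector_jump (e : conf) (x : int) : `|x| < M%:Z ->
  corrector (e, x + 1) + corrector (e, x - 1) - 2 * corrector (e, x) =
  occ R e x - window_density (e, x).
Proof.
move=> xM; rewrite -pyramid_laplacian_occ /corrector/=.
rewrite (_ : `|x + 1| <= M%:Z); last by lia.
rewrite (_ : `|x - 1| <= M%:Z); last by lia.
rewrite (ltW xM) /laplacian sumrB big_split/= -mulr_sumr.
under [in X in _ * (X + _ - _)]eq_bigr do rewrite addrAC.
under [in X in _ * (_ + X - _)]eq_bigr do rewrite addrAC.
by ring.
Qed.

Variables (lambda rho : R).
Hypothesis lambda01 : 0 <= lambda <= 1.
Hypothesis rho01 : 0 <= rho <= 1.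

Definition observable (z : state) : R :=
  (2 - lambda * occ R z.1 z.2) * (occ R z.1 z.2 - rho).

(** Both parts of the generator act alike on functions that are linear in the
    environment seen from the walk, so that the jump rate factors out as the
    weight [1 + (1 - lambda * occ)] of the observable. *)
Lemma Ljoint_corrector (e : conf) (x : int) : `|x| < M%:Z ->
  Ljoint lambda corrector (e, x) =
  (2 - lambda * occ R e x) * (occ R e x - window_density (e, x)).
Proof.
move=> xM; rewrite /Ljoint corrector_exchange corrector_jump// (ltW xM).
by rewrite -/(occ R e x); ring.
Qed.

Lemma norm_Ljoint_corrector (z : state) :
  `|Ljoint lambda corrector z| <= 5 * n%:R ^+ 2.
Proof.
case: z => e x; rewrite /Ljoint corrector_exchange.
have n1 : 1 <= n%:R ^+ 2 :> R by rewrite exprn_ege1// ler1n.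
have : `|if `|x| <= M%:Z then occ R e x - window_density (e, x) else 0| <= 1.
  case: ifP => _; rewrite ?normr0//; have := window_density01 (e, x).
  by rewrite /occ ler_norml; case: (e x) => /= /andP[? ?]; apply/andP; split; lra.
have := norm_corrector (e, x); have := norm_corrector (e, x + 1).
have := norm_corrector (e, x - 1); have := jump_rate01 e x lambda01.
set c := _ + (1 - _); set E := if _ then _ else _.
set a1 := corrector _; set a2 := corrector _; set a3 := corrector _.
rewrite !ler_norml => /andP[c0 c1] /andP[? ?] /andP[? ?] /andP[? ?] /andP[? ?].
have : `|c * (a2 + a1 - 2 * a3)| <= 1 * (4 * n%:R ^+ 2).
  rewrite normrM (ger0_norm c0) ler_pM// ler_norml; apply/andP; split; lra.
by rewrite ler_norml => /andP[? ?]; apply/andP; split; lra.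
Qed.

Lemma norm_observable (z : state) : `|observable z| <= 2.
Proof.
have /andP[l0 l1] := lambda01; have /andP[r0 r1] := rho01.
rewrite /observable normrM -[leRHS]mulr1 /occ; case: (z.1 z.2) => /=;
  by apply: ler_pM => //; rewrite ler_norml; apply/andP; split; lra.
Qed.

Lemma observable_corrector (z : state) : (0 < M)%N ->
  `|observable z - Ljoint lambda corrector z| <=
  2 * (if `|z.2| < M%:Z then `|window_density z - rho| else 0) +
  7 * n%:R ^+ 2 * walk_spread M%:R z.
Proof.
case: z => e x M0; rewrite -[(e, x).2]/x; have MR : 0 < M%:R :> R by rewrite ltr0n.
have /andP[l0 l1] := lambda01.
have n1 : 1 <= n%:R ^+ 2 :> R by rewrite exprn_ege1// ler1n.
have [xM|Mx] := ltP `|x| M%:Z.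
  rewrite Ljoint_corrector// /observable/=.
  rewrite (_ : _ - _ = (2 - lambda * occ R e x) * (window_density (e, x) - rho)); last by ring.
  apply: ler_wpDr; first by rewrite mulr_ge0 ?walk_spread_ge0// mulr_ge0// sqr_ge0.
  rewrite normrM ler_wpM2r// ler_norml /occ.
  by case: (e x) => /=; apply/andP; split; lra.
rewrite walk_spread_far//; last first.
  by rewrite -intr_norm -[M%:R]/(M%:Z%:~R) ler_int.
rewrite mulr0 add0r mulr1.
have := norm_observable (e, x); have := norm_Ljoint_corrector (e, x).
rewrite !ler_norml => /andP[? ?] /andP[? ?]; apply/andP; split; lra.
Qed.

End corrector.

(** * Concentration of the local density *)

Lemma expR_le_quad (R : realType) (u : R) : `|u| <= 2^-1 ->
  expR u <= 1 + u + 2 * u ^+ 2.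
Proof.
rewrite ler_norml => /andP[u1 u2].
have := expR_ge1Dx (- u); rewrite expRN => h.
have e0 := expR_gt0 u.
have h1 : (1 - u) * expR u <= 1.
  by rewrite -[leRHS](mulVf (lt0r_neq0 e0)) ler_pM2r.
have u3 : 0 < 1 - u by lra.
rewrite -(ler_pM2l u3) (le_trans h1)//; nra.
Qed.

Section tail.
Context (R : realType) (rho delta : R).
Hypothesis rho01 : 0 <= rho <= 1.
Hypothesis delta01 : 0 < delta <= 1.

(** One factor of the exponential Chebyshev bound for a deviation [delta] of the
    density, upwards or downwards. The exponent [theta = delta / 4] minimises
    [2 theta ^ 2 - theta delta], the bound that [expR_le_quad] gives for the
    logarithm of the mean of a factor. *)
Definition tilt (up : bool) (b : bool) : R :=
  expR (delta / 4 * ((if up then b%:R - rho else rho - b%:R) - delta)).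

Lemma tilt_gt0 up b : 0 < tilt up b. Proof. exact: expR_gt0. Qed.

Lemma norm_tilt up b : `|tilt up b| <= expR 1.
Proof.
rewrite gtr0_norm ?tilt_gt0// ler_expR.
have /andP[? ?] := rho01; have /andP[? ?] := delta01.
by case: up; case: b => /=; nra.
Qed.

Lemma mean_tilt up :
  0 <= rho * tilt up true + (1 - rho) * tilt up false <= expR (- (delta ^+ 2 / 8)).
Proof.
have /andP[r0 r1] := rho01; have /andP[d0 d1] := delta01.
apply/andP; split.
  by rewrite addr_ge0// mulr_ge0 ?(ltW (tilt_gt0 _ _))// subr_ge0.
pose u (b : bool) : R := delta / 4 * (if up then b%:R - rho else rho - b%:R).
have tE b : tilt up b = expR (- (delta ^+ 2 / 4)) * expR (u b).
  by rewrite -expRD; congr expR; rewrite /u; field.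
rewrite !tE mulrCA [X in _ + X]mulrCA -mulrDr.
have -> : - (delta ^+ 2 / 8) = - (delta ^+ 2 / 4) + delta ^+ 2 / 8 by field.
rewrite expRD ler_pM2l ?expR_gt0//.
apply: le_trans (expR_ge1Dx _).
have ub b : `|u b| <= 2^-1.
  rewrite ler_norml /u; apply/andP; case: up {tE u}; case: b => /=; split; nra.
have := expR_le_quad (ub true); have := expR_le_quad (ub false).
set e0 := expR _; set e1 := expR _ => h0 h1.
apply: (@le_trans _ _ (rho * (1 + u true + 2 * u true ^+ 2) +
  (1 - rho) * (1 + u false + 2 * u false ^+ 2))).
  by apply: lerD; apply: ler_wpM2l => //; rewrite subr_ge0.
have -> : rho * (1 + u true + 2 * u true ^+ 2) +
    (1 - rho) * (1 + u false + 2 * u false ^+ 2) =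
    1 + delta ^+ 2 / 8 * (rho * (1 - rho)).
  by rewrite /u; case: up {tE u ub e0 e1 h0 h1} => /=; field.
rewrite lerD2l ler_piMr ?divr_ge0 ?sqr_ge0//; nra.
Qed.

Variable n : nat.
Hypothesis n0 : (0 < n)%N.

(** A deviation of the density beyond [delta] is at most 1, hence at most the
    exponential of the matching sign, which is then at least 1. *)
Definition density_tail (x : int) (z : state) : R :=
  product_obs (tilt true) [seq x + y | y <- annulus n] z +
  product_obs (tilt false) [seq x + y | y <- annulus n] z.

Lemma product_tilt_gt0 up s z : 0 < product_obs (tilt up) s z.
Proof. by apply: prodr_gt0 => y _; exact: tilt_gt0. Qed.

Lemma density_tailP (z : state) :
  `|window_density R n z - rho| <= delta + density_tail z.2 z.
Proof.
have /andP[r0 r1] := rho01; have /andP[d0 d1] := delta01.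
have n2 : (0 : R) < (2 * n)%:R by rewrite ltr0n muln_gt0.
have /andP[w0 w1] := window_density01 R n0 z.
set w := window_density R n z in w0 w1 *.
have prodE up : product_obs (tilt up) [seq z.2 + y | y <- annulus n] z =
    expR (delta / 4 * (2 * n)%:R * ((if up then w - rho else rho - w) - delta)).
  rewrite /product_obs big_map -expR_sum; congr expR.
  rewrite -mulr_sumr -[RHS]mulrA; congr (_ * _).
  have sumc (a : R) : \sum_(y <- annulus n) a = (2 * n)%:R * a.
    by rewrite big_const_seq count_predT iter_addr_0 size_annulus mulr_natl.
  have wE : (2 * n)%:R * w = \sum_(y <- annulus n) occ R z.1 (z.2 + y).
    by rewrite /w /window_density mulrA mulfV ?mul1r// gt_eqF.
  by rewrite /occ in wE; case: up => /=; rewrite !sumrB !sumc !mulrBr wE.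
have p1 := product_tilt_gt0 true [seq z.2 + y | y <- annulus n] z.
have p2 := product_tilt_gt0 false [seq z.2 + y | y <- annulus n] z.
have a0 : 0 <= delta / 4 * (2 * n)%:R by rewrite !mulr_ge0 ?ltW// invr_ge0.
have big_dev up : 0 <= (if up then w - rho else rho - w) - delta ->
    1 <= product_obs (tilt up) [seq z.2 + y | y <- annulus n] z.
  by move=> h; rewrite prodE -[leLHS]expR0 ler_expR mulr_ge0.
move: (big_dev true) (big_dev false) p1 p2; rewrite /density_tail.
move: (product_obs _ _ z) (product_obs _ _ z) => q1 q2 /= b1 b2 p1 p2.
rewrite ler_norml; apply/andP; split.
  by have [/b2|] := leP 0 (rho - w - delta); lra.
by have [/b1|] := leP 0 (w - rho - delta); lra.
Qed.

End tail.

(** * Riemann sums of right-continuous step paths *)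

Section riemann.
Context (R : realType).

(** The step functions whose integrals are the Riemann sums converge at each time:
    the right end points of the grid intervals approach it from the right, where
    the path is locally constant. *)
Lemma riemann_sum_cvg (phi : R -> R) (B t : R) : 0 < t ->
  (forall s, `|phi s| <= B) ->
  (forall s, 0 <= s -> \forall u \near s^'+, phi u = phi s) ->
  k.+1%:R^-1 * \sum_(j < k.+1) phi (j.+1%:R * (t / k.+1%:R)) @[k --> \oo] -->
  t^-1 * \int[lebesgue_measure]_(s in `[0, t]) phi s.
Proof.
move=> t0 phiB phiR.
pose h k : R := t / k.+1%:R.
have h0 k : 0 < h k by rewrite divr_gt0.
have hk k : k.+1%:R * h k = t by rewrite /h mulrC divfK.
pose I k j : set R := `[j%:R * h k, j.+1%:R * h k[%classic.
pose D : set R := `[0, t[%classic.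
have mD : measurable D by exact: measurable_itv.
pose step k s : R := \sum_(j < k.+1) phi (j.+1%:R * h k) * \1_(I k j) s.
have mstep k : measurable_fun [set: R] (step k).
  apply: measurable_sum => j; apply: measurable_funM; first exact: measurable_cst.
  by apply: measurable_indic; exact: measurable_itv.
have stepE k s : D s -> exists u, [/\ s < u, u <= s + h k & step k s = phi u].
  rewrite /D/= in_itv/= => /andP[s0 st].
  have sh0 : 0 <= s / h k by rewrite divr_ge0// ltW.
  have /andP[j1 j2] := truncn_itv sh0; set j := Num.truncn _ in j1 j2.
  have jk : (j < k.+1)%N.
    rewrite -(ltr_nat R) (le_lt_trans j1)// ltr_pdivrMr//; by rewrite hk.
  rewrite ler_pdivlMr// in j1; rewrite ltr_pdivrMr// in j2.
  exists (j.+1%:R * h k); split => //.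
    by rewrite -natr1 mulrDl mul1r lerD2r.
  rewrite /step (bigD1 (Ordinal jk))//= big1 => [|i ij].
    by rewrite addr0 indicE mem_set ?mulr1// /I/= in_itv/= j1 j2.
  rewrite indicE memNset ?mulr0// /I/= in_itv/= => /andP[i1 i2].
  case/negP: ij; apply/eqP/val_inj => /=; apply/esym/truncn_def.
  by rewrite ler_pdivlMr// ltr_pdivrMr// i1 i2.
have step_cvg s : D s -> step ^~ s @ \oo --> phi s.
  move=> Ds; have s0 : 0 <= s by move: Ds; rewrite /D/= in_itv/= => /andP[].
  have [e /= e0 He] := phiR s s0.
  apply: cvg_near_cst; have [m _ Hm] := near_infty_natSinv_lt (PosNum (divr_gt0 e0 t0)).
  exists m => // k /= mk; have [u [su us ->]] := stepE k s Ds; apply: He => //=.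
  rewrite distrC gtr0_norm ?subr_gt0//; apply: (@le_lt_trans _ _ (h k)).
    by rewrite lerBlDl.
  have := Hm k mk; rewrite /= ltr_pdivlMr// mulrC; exact.
have Dfin : (lebesgue_measure D < +oo)%E by rewrite lebesgue_measure_itv/=; case: ifP; rewrite ltry.
have bint f : bounded_measurable f -> lebesgue_measure.-integrable D (EFin \o f).
  move=> [mf [N fN]]; apply: measurable_bounded_integrable => //.
    exact: measurable_funTS.
  exists N; split; first exact: num_real.
  by move=> y Ny x _; exact: le_trans (fN x) (ltW Ny).
have bI k j : bounded_measurable (\1_(I k j) : R -> R).
  by apply: bm_indic; exact: measurable_itv.
have step_int k : \int[lebesgue_measure]_(s in D) step k s =
    h k * \sum_(j < k.+1) phi (j.+1%:R * h k).
  rewrite mulr_sumr /step.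
  have intI j : (j < k.+1)%N -> \int[lebesgue_measure]_(s in D) \1_(I k j) s = h k.
    move=> jk; rewrite /Rintegral integral_indic//; last exact: measurable_itv.
    rewrite (_ : I k j `&` D = I k j); last first.
      apply/setIidPl => s; rewrite /I /D /= !in_itv/= => /andP[js sj].
      rewrite (le_trans _ js)/=; last by rewrite mulr_ge0// ltW.
      by rewrite (lt_le_trans sj)// -(hk k) ler_pM2r// ler_nat.
    rewrite -[RHS]/(fine (h k)%:E); congr fine.
    apply: etrans (lebesgue_measure_itv _) _.
    by rewrite /= lte_fin ltr_pM2r// ltr_nat ltnSn -EFinB -natr1; congr EFin; ring.
  suff H m : (m <= k.+1)%N ->
      \int[lebesgue_measure]_(s in D) \sum_(j < m) phi (j.+1%:R * h k) * \1_(I k j) s =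
      \sum_(j < m) h k * phi (j.+1%:R * h k) by exact: H.
  elim: m => [|m IHm] mk.
    rewrite big_ord0; under eq_Rintegral do rewrite big_ord0.
    by rewrite Rintegral_cst// mul0r.
  under eq_Rintegral do rewrite big_ord_recr/=.
  rewrite RintegralD//; last 2 first.
  - by apply: bint; apply: bm_sum => j; apply: bmZ; exact: bI.
  - by apply: bint; apply: bmZ; exact: bI.
  rewrite IHm ?(ltnW mk)// big_ord_recr/= RintegralZl//; last exact: (bint _ (bI k m)).
  by rewrite intI// mulrC.
have mphi : measurable_fun D phi.
  apply: (measurable_fun_cvg (h := step)) => // k; exact: measurable_funTS.
have stepB k s : D s -> `|step k s| <= B by move=> /(stepE k)[u [_ _ ->]].
have [] := @dominated_convergence _ _ R lebesgue_measure D mD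
  (fun k s => (step k s)%:E) (EFin \o phi) (cst B%:E).
- by move=> k; apply/measurable_EFinP; exact: measurable_funTS (mstep k).
- exact/measurable_EFinP.
- apply: aeW => s Ds /=; apply: cvg_EFin; last exact: step_cvg.
  by apply: nearW.
- by have := bint (cst B); apply; exact: bm_cst.
- by apply: aeW => s k Ds /=; rewrite lee_fin; exact: stepB.
move=> iphi _ cv; rewrite -Rintegral_itv_bndo_bndc//.
have cvR : \int[lebesgue_measure]_(s in D) step k s @[k --> \oo] -->
    \int[lebesgue_measure]_(s in D) phi s.
  apply: (@fine_cvg _ _ _ _ (fun k => \int[lebesgue_measure]_(x in D) (step k x)%:E)%E).
  have finf : (\int[lebesgue_measure]_(x in D) (EFin \o phi) x)%E \is a fin_num.
    exact: integrable_fin_num.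
  by rewrite /Rintegral fineK.
have scale k x : t^-1 * (h k * x) = k.+1%:R^-1 * x.
  by rewrite /h mulrA [t^-1 * _]mulrA mulVf ?gt_eqF// mul1r.
rewrite (_ : (fun k => _) = fun k => t^-1 * \int[lebesgue_measure]_(s in D) step k s).
  exact: cvgMl_tmp.
by apply/funext => k; rewrite step_int scale.
Qed.

End riemann.

(** * The joint process *)

(** Convexity of [x ^ (m + 1)]. It makes one step of the Euler scheme map the
    bound of order [m + 1] at time [j h] below that at time [(j + 1) h]. *)
Lemma exprS_tangent (R : realType) (x : R) (m : nat) : 0 <= x ->
  x ^+ m.+1 + m.+1%:R * x ^+ m <= (x + 1) ^+ m.+1.
Proof.
move=> x0; elim: m => [|m IHm]; first by rewrite !expr1 expr0 mulr1.
rewrite [leRHS]exprS (le_trans _ (ler_wpM2l _ IHm)) ?addr_ge0//.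
rewrite -[m.+2%:R]natr1 ![x ^+ _.+1]exprS.
have : 0 <= m.+1%:R * x ^+ m by rewrite mulr_ge0// exprn_ge0.
by lra.
Qed.

Section process.
Context (R : realType) (rho lambda : R) (d : measure_display).
Context (Omega : measurableType d) (P : probability Omega R).
Variables (X : R -> Omega -> int) (eta : R -> Omega -> conf).

Definition joint (t : R) (w : Omega) : state := (eta t w, X t w).

Variable K : R -> R.-pker state ~> state.
Hypothesis rho01 : 0 <= rho <= 1.
Hypothesis lambda01 : 0 <= lambda <= 1.
Hypothesis mZ : forall t : R, 0 <= t -> measurable_fun [set: Omega] (joint t).
Hypothesis walk0 : {ae P, forall w, X 0 w = 0}.
Hypothesis conf0 : is_bernoulli_product rho (pushforward P (eta 0)).
Hypothesis gen : forall f : state -> R, local f ->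
  (exists M : R, forall z, `|f z| <= M) -> generates_on K (Ljoint lambda) f.
Hypothesis KP : markov_property P joint K.

Let P1 : P [set: Omega] = 1%E. Proof. exact: probability_setT. Qed.

Lemma forward_step1 (f : state -> R) (e : R) : local f ->
  (exists M : R, forall z, `|f z| <= M) -> 0 < e ->
  exists2 h0 : R, 0 < h0 & forall h s : R, 0 < h < h0 -> 0 <= s ->
    `|mean P (fun w => f (joint (s + h) w)) - mean P (fun w => f (joint s w)) -
      h * mean P (fun w => Ljoint lambda f (joint s w))| <= h * e.
Proof.
move=> lf fM e0.
have [h0 h00 H] := forward_step mZ KP (local_bm lf fM) (gen lf fM) e0.
exists h0 => // h s hh s0.
have := H h s s (fun=> 1) 1 hh _ (bm_cst _) _; rewrite s0 lexx => /(_ isT).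
have mean1 (F : Omega -> R) : mean P (fun w => 1 * F w) = mean P F.
  by apply: eq_mean => w; rewrite mul1r.
by rewrite mul1r !mean1; apply => _; rewrite normr1.
Qed.

Section product_observables.
Variables (g : bool -> R) (b : R).
Hypothesis gb : forall x, `|g x| <= b.

Let c := rho * g true + (1 - rho) * g false.

Definition conf_box (s : seq int) (A : int -> set bool) : set Omega :=
  [set w | forall x, x \in s -> A x (eta 0 w x)].

Lemma measurable_conf_box (s : seq int) (A : int -> set bool) :
  measurable (conf_box s A).
Proof.
pose f (z : state) : R := \1_[set e : conf | forall x, x \in s -> A x (e x)] z.1.
have mf : measurable_fun [set: state] f.
  apply: measurable_local => x; exists s => e e' ee'; rewrite /f !indicE.
  congr (nat_of_bool _)%:R; apply/idP/idP; rewrite !inE /= => h y ys.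
    by rewrite -ee'//; exact: h.
  by rewrite ee'//; exact: h.
apply/(@measurable_indicP _ _ R).
rewrite (_ : \1_(conf_box s A) = f \o joint 0); last by apply/funext => w; rewrite /f /= !indicE.
exact: measurableT_comp (mZ (lexx 0)).
Qed.

Lemma mean_conf_box (s : seq int) (A : int -> set bool) : uniq s ->
  mean P \1_(conf_box s A) =
  \prod_(x <- s) (rho * \1_(A x) true + (1 - rho) * \1_(A x) false).
Proof.
move=> us; apply: EFin_inj; rewrite mean_indic//; last exact: measurable_conf_box.
apply: (etrans (conf0 A us)); rewrite -prodEFin; apply: eq_bigr => x _.
by rewrite bernoulli_probE// !diracE !indicE.
Qed.

(** Expanding the factor at one site over its two values turns an expectation
    of products into the box probabilities of [is_bernoulli_product]. *)
Lemma mean_product_box (s1 s2 : seq int) (A : int -> set bool) :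
  uniq (s1 ++ s2) ->
  mean P (fun w => product_obs g s1 (joint 0 w) * \1_(conf_box s2 A) w) =
  c ^+ size s1 * \prod_(x <- s2) (rho * \1_(A x) true + (1 - rho) * \1_(A x) false).
Proof.
elim: s1 s2 A => [|y s1 IHs] s2 A us.
  rewrite expr0 mul1r -mean_conf_box//; apply: eq_mean => w.
  by rewrite /product_obs big_nil mul1r.
pose A' (v : bool) x := if x == y then [set v] else A x.
have us' : uniq (s1 ++ y :: s2).
  by rewrite -cat1s uniq_catCA.
have ys2 : y \notin s2.
  by move: us; rewrite /= mem_cat negb_or => /andP[/andP[]].
have bb v : bounded_measurable (fun w => product_obs g s1 (joint 0 w) *
    \1_(conf_box (y :: s2) (A' v)) w : R).
  apply: bmM; first exact: (bm_process mZ (lexx 0) (product_obs_bm gb s1)).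
  by apply: bm_indic; exact: measurable_conf_box.
have split_y w : product_obs g (y :: s1) (joint 0 w) * \1_(conf_box s2 A) w =
    g true * (product_obs g s1 (joint 0 w) * \1_(conf_box (y :: s2) (A' true)) w) +
    g false * (product_obs g s1 (joint 0 w) * \1_(conf_box (y :: s2) (A' false)) w).
  have boxE v : (w \in conf_box (y :: s2) (A' v)) =
      (eta 0 w y == v) && (w \in conf_box s2 A).
    apply/idP/andP; rewrite !inE.
      move=> h; split.
        by have := h y (mem_head _ _); rewrite /A' eqxx => ->.
      move=> x xs2; have := h x; rewrite inE xs2 orbT => /(_ isT).
      by rewrite /A'; case: eqP => // xy; rewrite -xy xs2 in ys2.
    move=> [/eqP yv h] x; rewrite inE /A'; case: eqP => [->//|_] /=; exact: h.
  rewrite !indicE !boxE /product_obs big_cons /=.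
  by case: (eta 0 w y) => /=; rewrite !(mulr0, mul0r, addr0, add0r) mulrA.
rewrite (eq_mean P split_y) (meanD P1); [|exact: bmZ|exact: bmZ].
rewrite !(meanZ P1)// !IHs// !big_cons /A' eqxx.
have E v : \prod_(x <- s2) (rho * \1_(if x == y then [set v] else A x) true +
    (1 - rho) * \1_(if x == y then [set v] else A x) false) =
    \prod_(x <- s2) (rho * \1_(A x) true + (1 - rho) * \1_(A x) false) :> R.
  apply: eq_big_seq => x xs2; case: eqP => // xy.
  by rewrite -xy xs2 in ys2.
have ind1 (u v : bool) : \1_[set v] u = (u == v)%:R :> R.
  by rewrite indicE; congr (nat_of_bool _)%:R; apply/idP/eqP; rewrite inE.
by rewrite !E !ind1 /= /c exprS; ring.
Qed.

Lemma mean_product_obs0 (s : seq int) : uniq s ->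
  mean P (fun w => product_obs g s (joint 0 w)) = c ^+ size s.
Proof.
move=> us; have := @mean_product_box s [::] (fun=> setT); rewrite cats0 => /(_ us).
rewrite big_nil mulr1 => <-; apply: eq_mean => w.
by rewrite indicE mem_set ?mulr1// => x; rewrite in_nil.
Qed.

(** The deviations [v_s] from the Bernoulli value satisfy
    [v_s' = sum over bonds (v_(swapped s) - v_s)] and vanish at time 0. The
    swapped lists have the same size [k], and at most [2 k] bonds contribute: the
    system is closed at fixed [k] and has norm at most [4 k]. Iterating it bounds
    [v_s] by the terms of the exponential series. Each iteration treats one [s]
    at a time, because the error of [forward_step] is not uniform in [s]. *)
Lemma product_obs_deviation (m : nat) (s : seq int) (t : R) : uniq s -> 0 <= t ->
  `|mean P (fun w => product_obs g s (joint t w)) - c ^+ size s| <=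
  2 * b ^+ size s * ((4 * size s)%:R * t) ^+ m / m`!%:R.
Proof.
have cb : `|c| <= b.
  have /andP[r0 r1] := rho01; have := gb true; have := gb false.
  rewrite !ler_norml => /andP[? ?] /andP[? ?]; rewrite /c; apply/andP; split; nra.
elim: m s t => [|m IHm] s t us t0.
  rewrite fact0 divr1 expr0 mulr1 (le_trans (ler_normB _ _))//.
  rewrite mulr_natl mulr2n lerD ?normrX ?lerXn2r ?nnegrE ?(le_trans _ cb)//.
  apply: (ler_norm_mean P1) => [|w]; last exact: (norm_product_obs gb).
  exact: (bm_process mZ t0 (product_obs_bm gb s)).
set k := size s; set a : R := (4 * k)%:R; set D := 2 * b ^+ k.
have D0 : 0 <= D by rewrite mulr_ge0// exprn_ge0// (le_trans _ cb).
have a0 : 0 <= a by exact: ler0n.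
pose v u := mean P (fun w => product_obs g s (joint u w)) - c ^+ k.
have v0 : v 0 = 0 by rewrite /v mean_product_obs0// subrr.
have dv u : 0 <= u -> `|mean P (fun w => Ljoint lambda (product_obs g s) (joint u w))| <=
    a * (D * ((a * u) ^+ m / m`!%:R)).
  move=> u0; set V := (X in D * X); have V0 : 0 <= V.
    by rewrite /V divr_ge0 ?ler0n// exprn_ge0// mulr_ge0.
  have bms (s' : seq int) : bounded_measurable (fun w => product_obs g s' (joint u w)).
    exact: (bm_process mZ u0 (product_obs_bm gb s')).
  have devs (s' : seq int) : uniq s' -> size s' = k ->
      `|mean P (fun w => product_obs g s' (joint u w)) - c ^+ k| <= D * V.
    by move=> us' sk; have := IHm s' u us' u0; rewrite sk /V /D mulrA.
  rewrite (eq_mean P (fun w => Ljoint_product_obs lambda g s (joint u w))).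
  rewrite (mean_sum P1); last by move=> y; exact: bmB.
  apply: (le_trans (ler_norm_sum _ _ _)).
  apply: (@le_trans _ _ (\sum_(y <- touching_bonds s) (2 * (D * V)))).
    apply: ler_sum => y _; rewrite (meanB P1)//.
    have := devs s us erefl; have := devs (map (swap_sites y) s).
    rewrite size_map (map_inj_uniq (inv_inj (swap_sitesK y))) => /(_ us erefl).
    by rewrite !ler_norml => /andP[? ?] /andP[? ?]; apply/andP; split; lra.
  rewrite big_const_seq count_predT iter_addr_0.
  rewrite -[leLHS]mulr_natl mulrA.
  apply: ler_wpM2r; [exact: mulr_ge0|].
  rewrite /a -(natrM _ _ 2) ler_nat.
  by rewrite (leq_trans (leq_mul (size_touching_bonds s) (leqnn 2)))// -/k; lia.
apply/ler_addgt0Pl => e e0.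
have [h0 h00 H] := @forward_step1 (product_obs g s) (e / (t + 1)) (local_product_obs g s)
  (ex_intro _ _ (norm_product_obs gb s)) (divr_gt0 e0 (ltr_wpDl t0 ltr01)).
have bound_ge0 : 0 <= D * (a * t) ^+ m.+1 / m.+1`!%:R.
  by rewrite divr_ge0 ?ler0n// mulr_ge0// exprn_ge0// mulr_ge0.
have [t_eq0|tn0] := eqVneq t 0.
  by rewrite [X in joint X]t_eq0 -/(v 0) v0 normr0 addr_ge0// ltW.
have tp : 0 < t by rewrite lt_neqAle eq_sym tn0.
pose N := (Num.truncn (t / h0)).+1; pose h := t / N%:R.
have Np : (0 : R) < N%:R by rewrite ltr0n.
have hp : 0 < h by rewrite divr_gt0.
have hh0 : h < h0.
  by rewrite ltr_pdivrMr// mulrC -ltr_pdivrMr//; exact: truncnS_gt.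
have euler j : `|v (j%:R * h)| <=
    D * (a * (j%:R * h)) ^+ m.+1 / m.+1`!%:R + j%:R * (h * (e / (t + 1))).
  elim: j => [|j IHj].
    by rewrite !mul0r v0 normr0 addr0 mulr0 exprS mul0r mulr0 mul0r.
  have u0 : 0 <= j%:R * h by rewrite mulr_ge0 ?ler0n ?ltW.
  have := H h (j%:R * h); rewrite hp hh0 => /(_ isT u0).
  rewrite -[X in joint (_ + X)]mul1r -mulrDl natr1.
  move: (dv _ u0) IHj; rewrite /v.
  set l := mean P _; set x' := mean P _; set x1 := mean P _ => lb IHj st.
  have tang : D * (a * (j%:R * h)) ^+ m.+1 / m.+1`!%:R +
      h * (a * (D * ((a * (j%:R * h)) ^+ m / m`!%:R))) <=
      D * (a * (j.+1%:R * h)) ^+ m.+1 / m.+1`!%:R.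
    have := @exprS_tangent R j%:R m (ler0n _ _); rewrite natr1 => tg.
    have -> : D * (a * (j.+1%:R * h)) ^+ m.+1 / m.+1`!%:R =
        D * (a * h) ^+ m.+1 / m.+1`!%:R * j.+1%:R ^+ m.+1.
      by clearbody h; rewrite !exprMn; ring.
    have -> : D * (a * (j%:R * h)) ^+ m.+1 / m.+1`!%:R +
        h * (a * (D * ((a * (j%:R * h)) ^+ m / m`!%:R))) =
        D * (a * h) ^+ m.+1 / m.+1`!%:R * (j%:R ^+ m.+1 + m.+1%:R * j%:R ^+ m).
      have : m`!%:R != 0 :> R by rewrite pnatr_eq0 -lt0n fact_gt0.
      have : m.+1%:R != 0 :> R by rewrite pnatr_eq0.
      clearbody h; rewrite factS natrM !exprMn !exprS.
      move: (m.+1%:R : R) (m`!%:R : R) (a ^+ m) (h ^+ m) => x y am hm x0 y0.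
      by field; rewrite x0 y0.
    apply: ler_wpM2l => //; rewrite divr_ge0 ?ler0n// mulr_ge0// exprn_ge0//.
    by rewrite mulr_ge0// ltW.
  rewrite -[X in _ <= _ + X * _]natr1 [X in _ <= _ + X]mulrDl mul1r.
  have hl : `|h * l| <= h * (a * (D * ((a * (j%:R * h)) ^+ m / m`!%:R))).
    by rewrite normrM gtr0_norm// ler_pM2l.
  move: IHj st hl; rewrite !ler_norml.
  move=> /andP[? ?] /andP[? ?] /andP[? ?]; apply/andP; split; lra.
have := euler N; rewrite /h (_ : N%:R * (t / N%:R) = t); last by field; rewrite gt_eqF.
move=> /le_trans; apply; rewrite addrC lerD2r mulrA (_ : N%:R * _ = t); last first.
  by field; rewrite gt_eqF.
by rewrite mulrCA ler_piMr ?ltW// ltr_pdivrMr ?mul1r ?ltrDl// ltr_wpDl.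
Qed.

(** The exclusion process keeps its Bernoulli product law: let the number of
    iterations in [product_obs_deviation] tend to infinity. *)
Lemma mean_product_obs (s : seq int) (t : R) : uniq s -> 0 <= t ->
  mean P (fun w => product_obs g s (joint t w)) = c ^+ size s.
Proof.
move=> us t0; apply/eqP; rewrite -subr_eq0 -normr_le0.
set dev := `|_|.
have := @pi_irrational.exp_fact R ((4 * size s)%:R * t).
move=> /(cvgMl_tmp (a := 2 * b ^+ size s)); rewrite mulr0 => cv0.
rewrite -(cvg_lim (@Rhausdorff R) cv0); apply: limr_ge; first exact: cvgP cv0.
by apply: nearW => m /=; rewrite mulrA; exact: product_obs_deviation.
Qed.

End product_observables.
Lemma mean_walk_spread0 (M : R) : 0 < M ->
  mean P (fun w => walk_spread M (joint 0 w)) = 0.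
Proof.
move=> M0; have bf := local_bm (local_walk_spread M)
  (ex_intro _ 1 (norm_walk_spread M0)).
have bZ := bm_process mZ (lexx 0) bf.
apply: EFin_inj; rewrite (mean_EFin P1 bZ).
rewrite (ae_eq_integral (cst 0%E))// ?integral0//.
  by apply/measurable_EFinP; case: bZ.
apply: filterS walk0 => w X0 _ /=.
by rewrite /walk_spread/= X0 expr0n min_l ?mul0r// sqr_ge0.
Qed.

Lemma mean_walk_spread (M : R) : 0 < M ->
  exists2 h0 : R, 0 < h0 & forall (h : R) (j : nat), 0 < h < h0 ->
    mean P (fun w => walk_spread M (joint (j%:R * h) w)) <= 3 * (j%:R * h) / M ^+ 2.
Proof.
move=> M0; have M2 : 0 < M ^+ 2 by rewrite exprn_gt0.
have fM : exists N : R, forall z, `|walk_spread M z| <= N.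
  by exists 1; exact: norm_walk_spread.
(* [2 / M ^ 2] comes from the generator, and [1 / M ^ 2] is left for the error of
   the time steps. *)
have [h0 h00 H] := forward_step1 (local_walk_spread M) fM (e := (M ^+ 2)^-1)
  ltac:(by rewrite invr_gt0).
exists h0 => // h j hh; have /andP[hp _] := hh.
elim: j => [|j IHj]; first by rewrite !mul0r mulr0 mul0r mean_walk_spread0.
have u0 : 0 <= j%:R * h by rewrite mulr_ge0 ?ler0n ?ltW.
have := H h (j%:R * h) hh u0; rewrite -[X in joint (_ + X)]mul1r -mulrDl natr1.
have bL : bounded_measurable (Ljoint lambda (walk_spread M)).
  apply: (@bm_generator _ _ _ K) => //; last exact: gen (local_walk_spread M) fM.
  exact: local_bm (local_walk_spread M) fM.
have Lb : mean P (fun w => Ljoint lambda (walk_spread M) (joint (j%:R * h) w)) <= 2 / M ^+ 2.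
  rewrite -[leRHS](mean_cst P1); apply: (ler_mean P1).
  - exact: (bm_process mZ u0 bL).
  - exact: bm_cst.
  - by move=> w; exact: Ljoint_walk_spread.
have {}Lb := ler_wpM2l (ltW hp) Lb.
rewrite ler_norml => /andP[_ st].
have E1 : 3 * (j.+1%:R * h) / M ^+ 2 =
    3 * (j%:R * h) / M ^+ 2 + h * (2 / M ^+ 2) + h / M ^+ 2.
  by rewrite -natr1; ring.
by rewrite E1; lra.
Qed.

Hypothesis right_walk : forall w s, 0 <= s -> \forall u \near s^'+, X u w = X s w.
Hypothesis right_conf : forall w y s, 0 <= s ->
  \forall u \near s^'+, eta u w y = eta s w y.

Lemma bm_observable : bounded_measurable (observable lambda rho).
Proof.
split.
  apply: measurable_local => x; exists [:: x] => e e' ee'.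
  by rewrite /observable /occ /= ee'// mem_head.
by exists 2 => z; exact: norm_observable.
Qed.

Lemma observable_right_cst w s : 0 <= s ->
  \forall u \near s^'+, observable lambda rho (joint u w) = observable lambda rho (joint s w).
Proof.
move=> s0; have := right_walk w s0; have := right_conf w (X s w) s0.
apply: filterS2 => u eu Xu; rewrite /observable /occ /joint/= Xu.
by rewrite eu.
Qed.

Section one_scale.
Variables (n M : nat) (delta t : R).
Hypothesis n0 : (0 < n)%N.
Hypothesis M0 : (0 < M)%N.
Hypothesis delta01 : 0 < delta <= 1.
Hypothesis t0 : 0 < t.

Let LF := Ljoint lambda (corrector R n M).

(** The density term is summed over all positions in [-M, M], regardless of
    [z.2], because the position is correlated with the environment, whose law is
    explicit around deterministic sites. *)
Definition remainder (z : state) : R :=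
  2 * (\sum_(x <- window M) density_tail rho delta n x z) +
  7 * n%:R ^+ 2 * walk_spread M%:R z.

Definition remainder_bound : R :=
  4 * (2 * M).+1%:R * expR (- (delta ^+ 2 / 8)) ^+ (2 * n) +
  21 * n%:R ^+ 2 * t / M%:R ^+ 2.

Lemma bm_product_tilt up (s : seq int) : bounded_measurable (product_obs (tilt rho delta up) s).
Proof. exact: product_obs_bm (norm_tilt rho01 delta01 up) s. Qed.

Lemma bm_density_tail x : bounded_measurable (density_tail rho delta n x).
Proof. by apply: bmD; exact: bm_product_tilt. Qed.

Lemma bm_walk_spread : bounded_measurable (walk_spread M%:R : state -> R).
Proof.
apply: local_bm (local_walk_spread _) _; exists 1.
by apply: norm_walk_spread; rewrite ltr0n.
Qed.

Lemma bm_remainder : bounded_measurable remainder.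
Proof.
apply: bmD; apply: bmZ; last exact: bm_walk_spread.
by apply: bm_sum => x; exact: bm_density_tail.
Qed.

Lemma remainder_ge0 z : 0 <= remainder z.
Proof.
rewrite addr_ge0// mulr_ge0 ?walk_spread_ge0 ?mulr_ge0 ?sqr_ge0//.
by rewrite sumr_ge0// => x _; rewrite addr_ge0// ltW// product_tilt_gt0.
Qed.

Lemma observable_remainder z :
  `|observable lambda rho z - LF z| <= 2 * delta + remainder z.
Proof.
apply: (le_trans (observable_corrector n0 lambda01 rho01 z M0)).
rewrite /remainder addrA lerD2r -mulrDr ler_wpM2l//.
have /andP[d0 _] := delta01.
have T0 x : 0 <= density_tail rho delta n x z.
  by rewrite addr_ge0// ltW// product_tilt_gt0.
have S0 : 0 <= \sum_(x <- window M) density_tail rho delta n x z by exact: sumr_ge0.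
case: ifP => [zM|_]; last by rewrite addr_ge0// ltW.
rewrite (le_trans (density_tailP rho01 delta01 n0 z))// lerD2l.
have zw : z.2 \in window M by rewrite mem_window ltW.
by rewrite (big_rem z.2 zw)/= lerDl sumr_ge0.
Qed.

Lemma mean_density_tail (x : int) (s : R) : 0 <= s ->
  mean P (fun w => density_tail rho delta n x (joint s w)) <=
  2 * expR (- (delta ^+ 2 / 8)) ^+ (2 * n).
Proof.
move=> s0.
have us : uniq [seq x + y | y <- annulus n].
  by rewrite map_inj_uniq ?uniq_annulus//; exact: addrI.
rewrite (meanD P1); try exact: (bm_process mZ s0 (bm_product_tilt _ _)).
have one up : mean P (fun w => product_obs (tilt rho delta up)
    [seq x + y | y <- annulus n] (joint s w)) <= expR (- (delta ^+ 2 / 8)) ^+ (2 * n).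
  rewrite (mean_product_obs (norm_tilt rho01 delta01 up) us s0).
  rewrite size_map size_annulus.
  have /andP[m0 m1] := mean_tilt rho01 delta01 up.
  by rewrite lerXn2r// nnegrE ltW// expR_gt0.
by rewrite mulrDl mul1r lerD.
Qed.

Lemma mean_remainder : exists2 h0 : R, 0 < h0 &
  forall (h : R) (j : nat), 0 < h < h0 -> j%:R * h <= t ->
    mean P (fun w => remainder (joint (j%:R * h) w)) <= remainder_bound.
Proof.
have MR : 0 < M%:R :> R by rewrite ltr0n.
have [h0 h00 H] := mean_walk_spread MR.
exists h0 => // h j hh jt; have /andP[hp _] := hh.
have u0 : 0 <= j%:R * h by rewrite mulr_ge0 ?ler0n ?ltW.
have bT x : bounded_measurable (fun w => density_tail rho delta n x (joint (j%:R * h) w)).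
  exact: (bm_process mZ u0 (bm_density_tail x)).
have bW := bm_process mZ u0 bm_walk_spread.
rewrite (meanD P1); [|by apply: bmZ; exact: bm_sum|exact: bmZ].
rewrite (meanZ P1); last exact: bm_sum.
rewrite (meanZ P1)// (mean_sum P1)//; apply: lerD.
  apply: (@le_trans _ _ (2 * \sum_(x <- window M) (2 * expR (- (delta ^+ 2 / 8)) ^+ (2 * n)))).
    by rewrite ler_wpM2l//; apply: ler_sum => x _; exact: mean_density_tail.
  rewrite big_const_seq count_predT iter_addr_0 size_window -[X in 2 * X]mulr_natl.
  by rewrite le_eqVlt; apply/orP; left; apply/eqP; ring.
apply: (@le_trans _ _ (7 * n%:R ^+ 2 * (3 * t / M%:R ^+ 2))).
  rewrite ler_wpM2l ?mulr_ge0 ?sqr_ge0//; apply: (le_trans (H h j hh)).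
  by rewrite ler_pM2r ?invr_gt0 ?exprn_gt0// ler_pM2l.
by rewrite le_eqVlt; apply/orP; left; apply/eqP; ring.
Qed.

Definition time_average (w : Omega) : R :=
  t^-1 * \int[lebesgue_measure]_(s in `[0, t]) observable lambda rho (joint s w).

Let Y (k : nat) (w : Omega) : R :=
  k.+1%:R^-1 * \sum_(j < k.+1) observable lambda rho (joint (j.+1%:R * (t / k.+1%:R)) w).

Let tp k (j : nat) : 0 <= j%:R * (t / k.+1%:R).
Proof. by rewrite mulr_ge0// divr_ge0// ltW. Qed.

Let bY k : bounded_measurable (Y k).
Proof.
apply: bmZ; apply: bm_sum => j; exact: (bm_process mZ (tp k _) bm_observable).
Qed.

Let Y_cvg w : Y ^~ w @ \oo --> time_average w.
Proof.
apply: (@riemann_sum_cvg R (fun s => observable lambda rho (joint s w)) 2) => //.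
  by move=> s; exact: norm_observable.
by move=> s; exact: observable_right_cst.
Qed.

Let norm_Y k w : `|Y k w| <= 2.
Proof.
rewrite /Y normrM ger0_norm ?invr_ge0// ler_pdivrMl ?ltr0n//.
apply: (le_trans (ler_norm_sum _ _ _)).
apply: (@le_trans _ _ (\sum_(j < k.+1) 2)).
  by apply: ler_sum => j _; exact: norm_observable.
by rewrite sumr_const card_ord -[leLHS]mulr_natl.
Qed.

Lemma measurable_time_average : measurable_fun [set: Omega] time_average.
Proof.
apply: (measurable_fun_cvg (h := Y)) => [k|w _]; first by case: (bY k).
exact: Y_cvg.
Qed.

(** A Lipschitz substitute for the indicator of [eps <= |x|], which passes to the
    limit of the Riemann sums. *)
Let excess (eps x : R) : R := Num.max (`|x| - eps / 2) 0.

Let bm_excess eps k : bounded_measurable (fun w => excess eps (Y k w)).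
Proof.
apply: bm_max; last exact: bm_cst.
by apply: bmB; [exact: bm_norm|exact: bm_cst].
Qed.

(** The Riemann sum is bounded by that of [L corrector], by [2 delta <= eps / 4] and
    by that of the remainder; the first is replaced by its square through
    [a <= a ^ 2 / eps + eps / 4], so that the two constants add up to at most
    the threshold [eps / 2]. *)
Lemma mean_excess (eps : R) : 0 < eps -> 8 * delta <= eps ->
  \forall k \near \oo, mean P (fun w => excess eps (Y k w)) <=
    35 * n%:R ^+ 4 / t / eps + remainder_bound.
Proof.
move=> eps0 deps.
have n1 : 1 <= n%:R ^+ 2 :> R by rewrite exprn_ege1// ler1n.
have np : 0 < n%:R ^+ 2 :> R by exact: lt_le_trans ltr01 n1.
have [h1 h10 H1] := mean_remainder.
have lF : local (corrector R n M) by exact: local_corrector.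
have bF : exists N : R, forall z, `|corrector R n M z| <= N.
  by exists (n%:R ^+ 2) => z; exact: (norm_corrector R M n0).
have bfF := local_bm lF bF.
have bLF : bounded_measurable LF by apply: (bm_generator bfF); exact: gen.
have [h2 h20 H2] := additive_functional_moment mZ KP bfF (gen lF bF)
  (divr_gt0 np t0) (norm_corrector R M n0) (norm_Ljoint_corrector M n0 lambda01).
pose hm := Num.min h1 h2.
have hm0 : 0 < hm by rewrite lt_min h10 h20.
(* The mesh must satisfy the two bounds on [h], and [5 n ^ 2 t <= k] absorbs the
   diagonal terms of the second moment into the others. *)
pose k0 := maxn (Num.truncn (t / hm)) (Num.truncn (5 * n%:R ^+ 2 * t)).
exists k0 => // k /= k0k.
set N : R := k.+1%:R; have N0 : 0 < N by rewrite ltr0n.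
pose h := t / N; have hp : 0 < h by rewrite divr_gt0.
have hhm : h < hm.
  rewrite ltr_pdivrMr// mulrC -ltr_pdivrMr//; apply: (lt_le_trans (truncnS_gt _)).
  by rewrite ler_nat ltnS (leq_trans (leq_maxl _ _) k0k).
have NG : 5 * n%:R ^+ 2 * t <= N.
  apply/ltW; apply: (lt_le_trans (truncnS_gt _)).
  by rewrite ler_nat ltnS (leq_trans (leq_maxr _ _) k0k).
have [hh1 hh2] : 0 < h < h1 /\ 0 < h < h2.
  by move: hhm; rewrite /hm lt_min hp => /andP[-> ->].
pose S w := \sum_(j < k.+1) LF (joint (j.+1%:R * h) w).
pose Q w := \sum_(j < k.+1) remainder (joint (j.+1%:R * h) w).
have bS : bounded_measurable S.
  by apply: bm_sum => j; exact: (bm_process mZ (tp k _) bLF).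
have bQ : bounded_measurable Q.
  by apply: bm_sum => j; exact: (bm_process mZ (tp k _) bm_remainder).
have bS2 : bounded_measurable (fun w => S w ^+ 2).
  by under eq_fun do rewrite expr2; exact: bmM.
have Q0 w : 0 <= Q w by apply: sumr_ge0 => j _; exact: remainder_ge0.
have pointwise w : excess eps (Y k w) <= (N ^+ 2 * eps)^-1 * S w ^+ 2 + N^-1 * Q w.
  have YS : `|Y k w| <= N^-1 * `|S w| + 2 * delta + N^-1 * Q w.
    pose O (j : 'I_k.+1) := observable lambda rho (joint (j.+1%:R * h) w) -
      LF (joint (j.+1%:R * h) w).
    have -> : Y k w = N^-1 * (S w + \sum_(j < k.+1) O j).
      by rewrite /Y /S -big_split/=; congr (_ * _); apply: eq_bigr => j _; rewrite addrC subrK.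
    rewrite normrM (gtr0_norm (x := N^-1)) ?invr_gt0//.
    have -> : N^-1 * `|S w| + 2 * delta + N^-1 * Q w =
        N^-1 * (`|S w| + (N * (2 * delta) + Q w)) by field; rewrite gt_eqF.
    rewrite ler_pM2l ?invr_gt0// (le_trans (ler_normD _ _))// lerD2l.
    apply: (le_trans (ler_norm_sum _ _ _)).
    have -> : N * (2 * delta) + Q w =
        \sum_(j < k.+1) (2 * delta + remainder (joint (j.+1%:R * h) w)).
      by rewrite big_split/= sumr_const card_ord -[X in _ = X + _]mulr_natl.
    by apply: ler_sum => j _; exact: observable_remainder.
  rewrite /excess ge_max; apply/andP; split; last first.
    apply: addr_ge0; last by rewrite mulr_ge0// invr_ge0 ler0n.
    by apply: mulr_ge0; rewrite ?sqr_ge0// invr_ge0 mulr_ge0 ?sqr_ge0// ltW.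
  have -> : (N ^+ 2 * eps)^-1 * S w ^+ 2 = (N^-1 * `|S w|) ^+ 2 / eps.
    by rewrite exprMn real_normK ?num_real//; field; rewrite !gt_eqF.
  move: (N^-1 * `|S w|) (N^-1 * Q w) (`|Y k w|) YS => a q y YS.
  have amgm : a <= a ^+ 2 / eps + eps / 4.
    rewrite -(ler_pM2r eps0) mulrDl divfK ?gt_eqF//.
    by have := sqr_ge0 (a - eps / 2); nra.
  lra.
apply: (@le_trans _ _ (mean P (fun w => (N ^+ 2 * eps)^-1 * S w ^+ 2 + N^-1 * Q w))).
  apply: (ler_mean P1) => //.
  by apply: bmD; exact: bmZ.
rewrite (meanD P1); [|exact: bmZ|exact: bmZ]; rewrite !(meanZ P1)//.
apply: lerD.
  apply: (@le_trans _ _ ((N ^+ 2 * eps)^-1 * (35 * n%:R ^+ 4 * N ^+ 2 / t))).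
    rewrite ler_pM2l ?invr_gt0 ?mulr_gt0 ?exprn_gt0//.
    apply: (le_trans (H2 h k.+1 hh2)); rewrite -/N /h.
    have -> : N * (5 * n%:R ^+ 2) ^+ 2 + 2 * N * (2 * (5 * n%:R ^+ 2) * n%:R ^+ 2 / (t / N) +
        N * (5 * n%:R ^+ 2 * (n%:R ^+ 2 / t))) =
        5 * N * n%:R ^+ 2 / t * (5 * n%:R ^+ 2 * t) + 30 * n%:R ^+ 4 * N ^+ 2 / t :> R.
      by field; rewrite !gt_eqF.
    have -> : 35 * n%:R ^+ 4 * N ^+ 2 / t =
        5 * N * n%:R ^+ 2 / t * (n%:R ^+ 2 * N) + 30 * n%:R ^+ 4 * N ^+ 2 / t :> R.
      by field; rewrite gt_eqF.
    rewrite lerD2r ler_wpM2l//.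
      by apply: divr_ge0; [rewrite !mulr_ge0// ltW|exact: ltW].
    by rewrite (le_trans NG)// ler_peMl// ltW.
  rewrite le_eqVlt; apply/orP; left; apply/eqP.
  by field; rewrite !gt_eqF.
rewrite (mean_sum P1); last first.
  by move=> j; exact: (bm_process mZ (tp k _) bm_remainder).
rewrite ler_pdivrMl//.
apply: (@le_trans _ _ (\sum_(j < k.+1) remainder_bound)).
  apply: ler_sum => j _; apply: H1 => //.
  have -> : t = N * h by rewrite /h mulrC divfK// gt_eqF.
  by rewrite ler_pM2r// ler_nat.
by rewrite sumr_const card_ord -[leLHS]mulr_natl.
Qed.

Lemma deviation_bound (eps : R) : 0 < eps -> 8 * delta <= eps ->
  (P [set w | (eps <= `|time_average w|)%R] <=
   (2 / eps * (35 * n%:R ^+ 4 / t / eps + remainder_bound))%:E)%E.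
Proof.
move=> eps0 deps.
have mA := measurable_time_average.
set A := [set w | _].
have mAs : measurable A.
  have := measurableT_comp (@normr_measurable R setT) mA.
  move=> /(_ measurableT _ (measurable_itv `[eps, +oo[)); rewrite setTI.
  by congr measurable; apply/seteqP; split => w; rewrite /A/= in_itv/= andbT.
have exc_cvg w : excess eps (Y k w) @[k --> \oo] --> excess eps (time_average w).
  have lip x y : `|excess eps x - excess eps y| <= `|x - y|.
    apply: le_trans (ler_dist_dist x y); rewrite /excess.
    move: `|x| `|y| => a b; have := ler_norm (a - b); have := ler_norm (- (a - b)).
    rewrite normrN ler_norml.
    case: (leP (a - eps / 2) 0) => ?; case: (leP (b - eps / 2) 0) => ? ? ?;
      apply/andP; split; lra.
  apply/cvgrPdist_lt => e e0; have /cvgrPdist_lt/(_ e e0) := @Y_cvg w.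
  by apply: filterS => k; exact: le_lt_trans.
have mexc k : measurable_fun [set: Omega] (fun w => excess eps (Y k w)).
  by have [] := bm_excess eps k.
have excB k w : `|excess eps (Y k w)| <= 2.
  rewrite /excess ger0_norm ?le_max ?lexx ?orbT// ge_max ler0n andbT.
  by have := norm_Y k w; lra.
have lim_le : mean P (fun w => excess eps (time_average w)) <=
    35 * n%:R ^+ 4 / t / eps + remainder_bound.
  have cv := mean_cvg P1 mexc excB exc_cvg.
  rewrite -(cvg_lim (@Rhausdorff R) cv); apply: limr_le; first exact: cvgP cv.
  exact: mean_excess.
have bA : bounded_measurable (fun w => excess eps (time_average w)).
  split; first exact: (measurable_fun_cvg (h := fun k w => excess eps (Y k w))).
  exists 2 => w.
  have cv : `|excess eps (Y k w)| @[k --> \oo] --> `|excess eps (time_average w)|.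
    by apply: cvg_norm; exact: exc_cvg.
  rewrite -(cvg_lim (@Rhausdorff R) cv); apply: limr_le; first exact: cvgP cv.
  exact: nearW.
rewrite -mean_indic// lee_fin.
apply: le_trans (ler_wpM2l _ lim_le); last by rewrite divr_ge0// ltW.
rewrite -(meanZ P1)//; apply: (ler_mean P1); [exact: bm_indic|exact: bmZ|].
move=> w; rewrite indicE /excess; have [|_] := boolP (w \in A); last first.
  by rewrite mulr_ge0 ?le_max ?lexx ?orbT// divr_ge0// ltW.
rewrite inE /A/= => wA; have e2 : 2 / eps * (eps / 2) = 1 by field; rewrite gt_eqF.
by rewrite -[leLHS]e2 ler_pM2l ?divr_gt0// le_max; apply/orP; left; lra.
Qed.

End one_scale.
End process.

(** * Choice of the scales *)

Lemma truncnS_bounds (R : realType) (x : R) : 1 <= x ->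
  x <= (Num.truncn x).+1%:R <= 2 * x.
Proof.
move=> x1; have x0 : 0 <= x by rewrite (le_trans ler01).
have /andP[l u] := truncn_itv x0; rewrite (ltW u)/= -natr1; lra.
Qed.

(** From [u <= expR u] at [u = c x / (m + 1)], raised to the power [m + 1]. *)
Lemma expR_sub_poly (R : realType) (c x : R) (m : nat) : 0 < c -> 0 <= x ->
  x ^+ m.+1 * expR (- (c * x)) <= (m.+1%:R / c) ^+ m.+1.
Proof.
move=> c0 x0; rewrite expRN ler_pdivrMr ?expR_gt0//.
have m0 : (0 : R) < m.+1%:R by rewrite ltr0n.
rewrite (_ : expR (c * x) = expR (c * x / m.+1%:R) ^+ m.+1); last first.
  by rewrite -expRM_natr divfK// gt_eqF.
rewrite -exprMn lerXn2r// ?nnegrE//; first by rewrite mulr_ge0 ?expR_ge0// divr_ge0// ltW.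
rewrite mulrC -ler_pdivrMr ?divr_gt0// invf_div mulrA [x * c]mulrC.
by apply: le_trans (expR_ge1Dx _); rewrite lerDr.
Qed.

Definition deviation_constant (R : realType) (eps delta : R) : R :=
  2 / eps * (560 / eps + 20 * (16 / (delta ^+ 2 / 4)) ^+ 16 + 84).

(** Write [x = t ^ (1/15)]. The three error terms are [n ^ 4 / t ~ x ^ (- 11)],
    [M * expR (- c n) ~ x ^ 15 * expR (- c x)] and [n ^ 2 t / M ^ 2 ~ x ^ (- 13)]. A
    power of [t] is needed for [n], to let the exponential beat the number [M] of
    positions, and it has to stay well below [t ^ (1/4)]. *)
Lemma deviation_rate (R : realType) (eps delta t : R) :
  0 < eps -> 0 < delta -> 1 < t ->
  2 / eps * (35 * (Num.truncn (t `^ 15^-1)).+1%:R ^+ 4 / t / eps +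
    remainder_bound (Num.truncn (t `^ 15^-1)).+1 (Num.truncn t).+1 delta t) <=
  deviation_constant eps delta * t `^ (- 15^-1).
Proof.
set n := (Num.truncn (t `^ 15^-1)).+1.
move=> eps0 d0 t1; have t0 : 0 < t by lra.
rewrite powRN; set x := t `^ 15^-1 in n *.
have x0 : 0 < x by exact: powR_gt0.
have xt : x ^+ 15 = t by rewrite /x -powR_mulrn ?powR_ge0// -powRrM mulVf ?powRr1 ?ltW.
have x1 : 1 <= x by rewrite -(@expr_ge1 R 15) ?xt ?(ltW x0)// ltW.
have /andP[xn nx] := truncnS_bounds x1; rewrite -/n in xn nx.
have /andP[tM Mt] := truncnS_bounds (ltW t1).
set M := (Num.truncn t).+1 in tM Mt *; set c := delta ^+ 2 / 4.
have c0 : 0 < c by rewrite divr_gt0 ?exprn_gt0.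
rewrite /deviation_constant -[leRHS]mulrA ler_pM2l ?divr_gt0// /remainder_bound.
rewrite -/c [leLHS]addrA [leRHS]mulrDl [X in _ <= X + _]mulrDl; apply: lerD; [apply: lerD|].
- have -> : 35 * n%:R ^+ 4 / t / eps = 35 / eps * (n%:R ^+ 4 / t) by ring.
  have -> : 560 / eps / x = 35 / eps * (16 / x) by ring.
  rewrite ler_pM2l ?divr_gt0// ler_pdivrMr// -xt mulrAC ler_pdivlMr//.
  apply: (@le_trans _ _ ((2 * x) ^+ 4 * x)).
    by rewrite ler_pM2r// lerXn2r// nnegrE ltW// mulr_gt0.
  rewrite exprMn -natrX -mulrA ler_pM2l// -exprSr ler_weXn2l//.
- have Mx : (2 * M).+1%:R <= 5 * x ^+ 15.
    rewrite xt -natr1 natrM; lra.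
  have qx : expR (- (delta ^+ 2 / 8)) ^+ (2 * n) <= expR (- (c * x)).
    rewrite -expRM_natr ler_expR natrM /c.
    have : delta ^+ 2 * x <= delta ^+ 2 * n%:R by rewrite ler_pM2l// exprn_gt0.
    lra.
  rewrite ler_pdivlMr//.
  apply: (@le_trans _ _ (20 * (x ^+ 16 * expR (- (c * x))))).
    rewrite (_ : 20 * _ = 4 * (5 * x ^+ 15) * expR (- (c * x)) * x); last by rewrite exprSr; ring.
    rewrite ler_pM2r// ler_pM// ?exprn_ge0 ?expR_ge0//.
    by rewrite ler_pM2l.
  by rewrite ler_pM2l//; exact: (@expR_sub_poly _ c x 15 c0 (ltW x0)).
have M0 : 0 < M%:R :> R by rewrite (lt_le_trans t0).
apply: (@le_trans _ _ (21 * (2 * x) ^+ 2 / t)).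
  rewrite ler_pdivrMr ?exprn_gt0//.
  have -> : 21 * (2 * x) ^+ 2 / t * M%:R ^+ 2 = 21 * ((2 * x) ^+ 2 * (M%:R ^+ 2 / t)) by ring.
  rewrite -[leLHS]mulrA ler_pM2l//.
  have n2x : n%:R ^+ 2 <= (2 * x) ^+ 2.
    by rewrite lerXn2r// ?nnegrE// ltW// mulr_gt0.
  have tMM : t <= M%:R ^+ 2 / t.
    by rewrite ler_pdivlMr// -expr2 lerXn2r// nnegrE ltW.
  by apply: ler_pM => //; exact: ltW.
rewrite ler_pdivrMr// mulrAC ler_pdivlMr// -xt.
rewrite (_ : 21 * (2 * x) ^+ 2 * x = 84 * x ^+ 3); last by ring.
by rewrite ler_pM2l// ler_weXn2l.
Qed.

Theorem theorem2p3 (R : realType) (rho lambda : R)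
    (rho01 : 0 <= rho <= 1) (lambda01 : 0 <= lambda <= 1)
    (eps : R) (eps_gt0 : 0 < eps) :
  exists T C : R, [/\ 0 < T, 0 < C &
    forall (d : measure_display) (Omega : measurableType d)
      (P : probability Omega R)
      (X : R -> Omega -> int) (eta : R -> Omega -> conf),
      is_joint_process rho lambda P X eta ->
      let xi := environment X eta in
      forall t : R, T < t ->
        (P [set w : Omega | (eps <= t^-1 *
              `| \int[lebesgue_measure]_(s in `[0, t])
                   ((2 - lambda * (xi s w 0)%:R) * ((xi s w 0)%:R - rho)) |)%R]
         <= (C * t `^ (- 15^-1))%:E)%E].
Proof.
pose delta := Num.min (eps / 8) 1.
have d01 : 0 < delta <= 1 by rewrite lt_min ge_min lexx orbT ltr01 divr_gt0.
have d8 : 8 * delta <= eps by rewrite mulrC -ler_pdivlMr// ge_min lexx.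
have /andP[d0 _] := d01.
exists 1, (deviation_constant eps delta); split => //.
  rewrite /deviation_constant mulr_gt0 ?divr_gt0// addr_gt0// addr_gt0 ?divr_gt0//.
  by rewrite mulr_gt0// exprn_gt0// divr_gt0// divr_gt0// exprn_gt0.
move=> d Omega P X eta [mZ Xr er X0 e0 [K [_ gen KP]]] xi t t1.
have t0 : 0 < t by lra.
have Xr' w s : 0 <= s -> \forall u \near s^'+, X u w = X s w.
  by move=> s0; have [] := Xr w s s0.
have er' w y s : 0 <= s -> \forall u \near s^'+, eta u w y = eta s w y.
  by move=> s0; have [] := er w y s s0.
have -> : [set w : Omega | (eps <= t^-1 *
      `| \int[lebesgue_measure]_(s in `[0, t])
           ((2 - lambda * (xi s w 0)%:R) * ((xi s w 0)%:R - rho)) |)%R] =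
    [set w | (eps <= `|time_average rho lambda X eta t w|)%R].
  apply/funext => w /=; rewrite /time_average normrM (gtr0_norm (x := t^-1)) ?invr_gt0//.
  congr (is_true (eps <= _ * `|_|)); apply: eq_Rintegral => s _.
  by rewrite /observable /occ /xi /environment /shift_conf /= add0r.
apply: le_trans (deviation_bound (n := (Num.truncn (t `^ 15^-1)).+1)
  (M := (Num.truncn t).+1) rho01 lambda01 mZ X0 e0 gen KP Xr' er' _ _ d01 t0 eps_gt0 d8) _ => //.
by rewrite lee_fin; exact: deviation_rate.
Qed.
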